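(* Let $F\in K[X,Y,Z,U,V]$ be a Perazzo form of degree $d\ge5$ such that $A_F$ has the minimal Hilbert function $(1,5,6,6,\dots,6,5,1)$. Then the nonzero graded Betti numbers $\beta_{i,j}=\beta^R_{ij}(A_F)=\dim_K[\operatorname{Tor}^R_i(A_F,K)]_j$ of $A_F$ over $R=K[x,y,z,u,v]$ are exactly: $\beta_{0,0}=1$; $\beta_{1,2}=9,\ \beta_{2,3}=17,\ \beta_{3,4}=12,\ \beta_{4,5}=3$; $\beta_{1,3}=1,\ \beta_{2,4}=3,\ \beta_{3,5}=3,\ \beta_{4,6}=1$; $\beta_{1,d-1}=1,\ \beta_{2,d}=3,\ \beta_{3,d+1}=3,\ \beta_{4,d+2}=1$; $\beta_{1,d}=3,\ \beta_{2,d+1}=12,\ \beta_{3,d+2}=17,\ \beta_{4,d+3}=9$; $\beta_{5,d+5}=1$. In particular the total Betti numbers are $1,14,35,35,14,1$.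
   Context: $K$ algebraically closed of characteristic zero. A Perazzo form here is $F=Xp_0+Yp_1+Zp_2+G$ with $p_0,p_1,p_2\in K[U,V]_{d-1}$ linearly independent and $G\in K[U,V]_d$; $R=K[x,y,z,u,v]$ acts on $K[X,Y,Z,U,V]$ by differentiation and $A_F=R/\operatorname{Ann}_RF$ is the associated Artinian Gorenstein algebra, with Hilbert function $\dim_K(A_F)_i$. *)

(* Defs.v *)
From HB Require Import structures.
From mathcomp Require Import all_boot all_order all_algebra.
From mathcomp.multinomials Require Import mpoly.
Set Implicit Arguments. Unset Strict Implicit. Unset Printing Implicit Defensive.
Import GRing.Theory.
Local Open Scope ring_scope.

(* Both R = K[x,y,z,u,v] and S = K[X,Y,Z,U,V] are modelled by {mpoly K[5]};
   variable index 0,1,2,3,4 <-> X,Y,Z,U,V (resp. x,y,z,u,v). *)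
Section Perazzo.
Variable K : fieldType.
Local Notation P := {mpoly K[5]}.

Definition var (i : nat) : P := 'X_(inord i).

Definition contract (g F : P) : P :=
  \sum_(m <- msupp g) g@_m *: F^`M[m].

Definition annF (F g : P) : Prop := contract g F = 0.

Definition in_KUV (p : P) : Prop :=
  forall m, m \in msupp p -> (m (inord 0) = 0 /\ m (inord 1) = 0 /\ m (inord 2) = 0)%N.

Definition perazzo_form (d : nat) (F : P) : Prop :=
  exists (p0 p1 p2 G : P),
    [/\ in_KUV p0, in_KUV p1, in_KUV p2 & in_KUV G] /\
    [/\ p0 \is (d.-1).-homog, p1 \is (d.-1).-homog, p2 \is (d.-1).-homog
        & G \is d.-homog] /\
    (forall a b c : K, a *: p0 + b *: p1 + c *: p2 = 0 -> [/\ a = 0, b = 0 & c = 0]) /\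
    F = var 0 * p0 + var 1 * p1 + var 2 * p2 + G.

(* dim_K (Pv / Qv) = n, for subspaces Qv <= Pv of a K-vector space V:
   there is a family of n vectors of Pv, linearly independent modulo Qv,
   spanning Pv modulo Qv. *)
Definition qdim_eq (V : lmodType K) (Pv Qv : V -> Prop) (n : nat) : Prop :=
  exists s : 'I_n -> V,
    (forall k, Pv (s k)) /\
    (forall a : 'I_n -> K, Qv (\sum_k a k *: s k) -> forall k, a k = 0) /\
    (forall v, Pv v -> exists a : 'I_n -> K, Qv (v - \sum_k a k *: s k)).

Definition hilb_eq (F : P) (i n : nat) : Prop :=
  qdim_eq (fun g : P => g \is i.-homog)
          (fun g : P => g \is i.-homog /\ annF F g) n.

(* Koszul complex K(x,y,z,u,v) (the free resolution of K) tensored with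
   a module: an element of the exterior algebra on e_0..e_4 with coefficients
   in R, the coefficient of e_S being c S. *)
Definition koszul := {ffun {set 'I_5} -> P}.

(* d(e_S) = sum_{k in S} (-1)^{#{l in S | l < k}} x_k e_{S \ k} *)
Definition kdiff (c : koszul) : koszul :=
  [ffun T : {set 'I_5} =>
     \sum_(k : 'I_5 | k \notin T)
        ((-1) ^+ #|[set l in T | (l < k)%N]| * 'X_k * c (k |: T))].

(* homological degree i, internal degree j: coefficient of e_S (deg |S| = i)
   homogeneous of degree j - i; everything else zero *)
Definition kchain (i j : nat) (c : koszul) : Prop :=
  forall S : {set 'I_5},
    if (#|S| == i) && (i <= j)%N then c S \is (j - i).-homog else c S == 0.

(* c represents 0 in K_* (x) A_F, A_F = R/Ann F *)
Definition kann (F : P) (c : koszul) : Prop := forall S, annF F (c S).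

(* cycles of (K_* (x) A_F)_{i,j}, lifted to R *)
Definition kcycle (F : P) (i j : nat) (c : koszul) : Prop :=
  kchain i j c /\ kann F (kdiff c).

(* boundaries of (K_* (x) A_F)_{i,j} (plus lifts of zero), lifted to R *)
Definition kbound (F : P) (i j : nat) (c : koszul) : Prop :=
  kchain i j c /\ exists b, kchain i.+1 j b /\ kann F (c - kdiff b).

(* beta_{i,j}(A_F) = dim_K [Tor_i^R(A_F,K)]_j = n, Tor computed via the
   Koszul resolution of K *)
Definition betti_eq (F : P) (i j n : nat) : Prop :=
  qdim_eq (kcycle F i j) (kbound F i j) n.

End Perazzo.

Definition betti_table (d i j : nat) : nat :=
  match i with
  | 0 => (j == 0) : nat
  | 1 => (j == 2) * 9 + (j == 3) * 1 + (j == d.-1) * 1 + (j == d) * 3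
  | 2 => (j == 3) * 17 + (j == 4) * 3 + (j == d) * 3 + (j == d.+1) * 12
  | 3 => (j == 4) * 12 + (j == 5) * 3 + (j == d.+1) * 3 + (j == d.+2) * 17
  | 4 => (j == 5) * 3 + (j == 6) * 1 + (j == d.+2) * 1 + (j == d.+3) * 9
  | 5 => (j == d + 5) : nat
  | _ => 0
  end%N.

Definition min_hilb (d i : nat) : nat :=
  (if i == 0 then 1 else if i == 1 then 5 else if (i <= d - 2) then 6
  else if i == d.-1 then 5 else if i == d then 1 else 0)%N.

(* Main.v *)
Require Import Defs.
From HB Require Import structures.
From mathcomp Require Import all_boot all_order all_algebra.
From mathcomp.multinomials Require Import ssrcomplements mpoly.
From mathcomp Require Import zify ring.
Set Implicit Arguments. Unset Strict Implicit. Unset Printing Implicit Defensive.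
Import GRing.Theory.
Local Open Scope ring_scope.

(* Write A = A_F and J = (x, y, z)A; since F is linear in X, Y, Z, the ideal J is
   killed by x, y and z. If a nonzero quadric g(u, v) killed J_1, an element of J_1
   would be determined by two scalars, against dim J_1 = 3; so dim A_2 = 6 leaves
   dim (u, v)J_1 = 3. A linear form l = u + bv injective on (u, v)J_1 then satisfies
   (u, v)J_1 = l J_1, is injective on A_2, and by dim A_2 = dim A_3 and duality
   satisfies l A_k = A_{k+1} for k >= 2 and is injective on A_k for 1 <= k <= d - 3.
   In coordinates containing l, a Koszul cycle with coefficients in such an A_k is
   determined by its components not involving l, which gives the rank of the Koszul
   differential on A_k for k <= d - 3; the ranks for k >= d - 2 follow by Gorenstein
   duality, and the Betti numbers are differences of these ranks. *)

(** * The Koszul complex of a family of endomorphisms *)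

(** The two scalars in the quadric argument: modulo g only two monomials of degree d - 1 in u, v
    survive (in suitable coordinates), and each sends J_1 into the line A_d. That a cycle is
    determined by its components avoiding l bounds the kernel from above; for its exact dimension
    these components must also extend. The obstacle is the exchange identity x_j l^{-1} x_t = x_t
    l^{-1} x_j. It is immediate on l A_{k-1}, but l A_1 has dimension 5 and misses the class of v^2
    in A_2. For d >= 6 injectivity of l on A_3 settles that class; for d = 5 it fails (dim A_3 = 6,
    dim A_4 = 5) and the symmetry of the Gorenstein pairing replaces it. The same class makes degree
    1 special: every variable but v maps A_1 into l A_1, so a component on a set containing v is
    confined to a hyperplane of A_1. A_F is realized as the space R.F of derivatives of F, inside
    the polynomials of degree at most d, so that all the linear algebra is finite-dimensional. *)

Section FfunSubspaces.
Variables (K : fieldType) (D : vectType K) (I : finType).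
Local Notation E := {ffun I -> D}.

Definition ffdelta (i : I) (v : D) : E := [ffun j => if j == i then v else 0].

Fact ffdelta_linear i : linear (ffdelta i).
Proof.
by move=> a u v; apply/ffunP=> j; rewrite !ffunE; case: eqP; rewrite ?scaler0 ?addr0.
Qed.
HB.instance Definition _ i :=
  GRing.isLinear.Build K D E _ (ffdelta i) (ffdelta_linear i).

Lemma ffun_sum_delta (c : E) : c = \sum_i ffdelta i (c i).
Proof.
apply/ffunP=> j; rewrite sum_ffunE (bigD1 j) //= ffunE eqxx big1 ?addr0 // => i.
by rewrite ffunE eq_sym => /negPf->.
Qed.

Definition ffspace (U : I -> {vspace D}) : {vspace E} :=
  (\sum_i linfun (ffdelta i) @: U i)%VS.

Lemma memv_ffspace (U : I -> {vspace D}) (c : E) : reflect (forall i, c i \in U i) (c \in ffspace U).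
Proof.
apply: (iffP idP) => [/memv_sumP[f fU ->] i | cU].
  rewrite sum_ffunE; apply: rpred_sum => j _.
  have /memv_imgP[v vU ->] := fU j isT; rewrite lfunE ffunE.
  by case: eqP => [->|_] //; apply: mem0v.
rewrite [c]ffun_sum_delta; apply: memv_sumr => i _.
by rewrite -[ffdelta _ _](lfunE (ffdelta i)) memv_img.
Qed.

Lemma dim_ffspace (U : I -> {vspace D}) : \dim (ffspace U) = (\sum_i \dim (U i))%N.
Proof.
have/directvP-> /= : directv (\sum_i linfun (ffdelta i) @: U i).
  apply/directv_sum_independent => f fU f0 i _.
  have /memv_imgP[v vU fi] := fU i isT.
  have := congr1 (fun c : E => c i) f0; rewrite sum_ffunE ffunE (bigD1 i) //= big1.
    by rewrite fi lfunE ffunE eqxx addr0 => ->; rewrite linear0.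
  move=> j ji; have /memv_imgP[w _ ->] := fU j isT.
  by rewrite lfunE ffunE eq_sym (negPf ji).
apply: eq_bigr => i _; apply: limg_dim_eq; apply/eqP; rewrite -subv0.
apply/subvP=> v /memv_capP[_]; rewrite memv_ker lfunE memv0 => /eqP/ffunP/(_ i).
by rewrite !ffunE eqxx => ->.
Qed.
End FfunSubspaces.

Section Koszul.
Variables (K : fieldType) (D : vectType K) (n : nat).
Local Notation E := {ffun {set 'I_n} -> D}.

Definition ksgn (k : 'I_n) (S : {set 'I_n}) : K :=
  (-1) ^+ #|[set l in S | (l < k)%N]|.

Definition koszul_map (x : 'I_n -> 'End(D)) (c : E) : E :=
  [ffun T : {set 'I_n} => \sum_(k | k \notin T) ksgn k T *: x k (c (k |: T))].

Fact koszul_map_linear x : linear (koszul_map x).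
Proof.
move=> a u v; apply/ffunP=> T; rewrite !ffunE scaler_sumr -big_split /=.
apply: eq_bigr => k _; rewrite !ffunE linearP scalerDr !scalerA.
by rewrite [_ * a]mulrC.
Qed.
HB.instance Definition _ x :=
  GRing.isLinear.Build K E E _ (koszul_map x) (koszul_map_linear x).

Definition kd x : 'End(E) := linfun (koszul_map x).

Lemma kdE x (c : E) (T : {set 'I_n}) : kd x c T = \sum_(k | k \notin T) ksgn k T *: x k (c (k |: T)).
Proof. by rewrite lfunE ffunE. Qed.

Lemma ksgnU1 j k (T : {set 'I_n}) : j \notin T ->
  ksgn k (j |: T) = (if (j < k)%N then -1 else 1) * ksgn k T.
Proof.
move=> jT; rewrite /ksgn.
have -> : [set l in j |: T | (l < k)%N] =
   if (j < k)%N then j |: [set l in T | (l < k)%N] else [set l in T | (l < k)%N].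
  apply/setP=> l; case: ifP => jk; rewrite !inE; have [->|_] := eqVneq l j;
   by rewrite ?jk ?andbF ?(negPf jT).
case: ifP => _; last by rewrite mul1r.
by rewrite cardsU1 inE (negPf jT) exprS.
Qed.

Lemma ksgn_sq k T : ksgn k T * ksgn k T = 1.
Proof. by rewrite /ksgn -exprD addnn -mul2n exprM sqrrN !expr1n. Qed.

(** The terms of (j, k) and (k, j) carry opposite signs and cancel by the exchange hypothesis. Two
    families are allowed because the lemma serves for [x] followed by itself and also for [g \o x]
    followed by [x], with [g] a left inverse of one variable. *)
Lemma kd_comp0 (x y : 'I_n -> 'End(D)) (c : E) :
  (forall (S : {set 'I_n}) j k, j \in S -> k \in S -> j != k -> x j (y k (c S)) = x k (y j (c S))) ->
  kd x (kd y c) = 0.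
Proof.
move=> H; apply/ffunP=> T; rewrite kdE ffunE.
pose G j k := (ksgn j T * ksgn k (j |: T)) *: x j (y k (c (k |: (j |: T)))).
have -> : \sum_(k | k \notin T) ksgn k T *: x k (kd y c (k |: T)) =
   \sum_(j | j \notin T) \sum_(k | (k \notin T) && (k != j)) G j k.
  apply: eq_bigr => j jT; rewrite kdE linear_sum scaler_sumr.
  apply: eq_big => [k|k _]; first by rewrite !inE negb_or andbC.
  by rewrite linearZ scalerA.
have GN j k : j \notin T -> k \notin T -> (j < k)%N -> G j k = - G k j.
  move=> jT kT jk; have nkj : k != j by apply: contraTneq jk => ->; rewrite ltnn.
  rewrite /G !ksgnU1 // jk ltnNge (ltnW jk) /= mulN1r mulrN scaleNr mul1r mulrC.
  rewrite setUCA; congr (- (_ *: _)); apply: H.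
  - by rewrite !inE eqxx ?orbT.
  - by rewrite !inE eqxx ?orbT.
  - by rewrite eq_sym.
under eq_bigr => j jT do rewrite (bigID (fun k : 'I_n => (k < j)%N)) /=.
rewrite big_split /= addrC.
under eq_bigr => j jT.
  rewrite (eq_bigl (fun k => (k \notin T) && (j < k)%N)); last first.
    by move=> k; rewrite -andbA -leqNgt [RHS]andbC [LHS]andbC ltn_neqAle val_eqE eq_sym.
  over.
under [X in _ + X]eq_bigr => j jT.
  rewrite (eq_bigl (fun k => (k \notin T) && (k < j)%N)); last first.
    by move=> k; rewrite -andbA; have [->|] := eqVneq k j; rewrite ?ltnn.
  over.
rewrite (exchange_big_dep (fun k : 'I_n => k \notin T)) /=; last by move=> j k _ /andP[].
rewrite -big_split /= big1 // => j jT.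
rewrite (eq_bigl (fun i : 'I_n => (i \notin T) && (i < j)%N)); last by move=> i; rewrite jT.
rewrite -big_split /= big1 // => k /andP[kT kj].
by rewrite GN // addNr.
Qed.

Definition chains (A : nat -> {vspace D}) (i k : nat) : {vspace E} :=
  ffspace (fun S : {set 'I_n} => if #|S| == i then A k else 0%VS).

Lemma chainsP (A : nat -> {vspace D}) i k (c : E) :
  reflect (forall S : {set 'I_n}, if #|S| == i then c S \in A k else c S == 0) (c \in chains A i k).
Proof.
apply: (iffP (memv_ffspace _ _)) => H S; have := H S; case: ifP => //.
  by rewrite memv0.
by rewrite memv0.
Qed.

Lemma dim_chains (A : nat -> {vspace D}) i k : \dim (chains A i k) = ('C(n, i) * \dim (A k))%N.
Proof.
rewrite dim_ffspace (bigID (fun S : {set 'I_n} => #|S| == i)) /=.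
rewrite [X in (_ + X)%N]big1 ?addn0; last by move=> S /negPf->; rewrite dimv0.
rewrite (eq_bigr (fun=> \dim (A k))) => [|S ->//].
have := card_draws 'I_n i; rewrite card_ord => <-; rewrite sum_nat_const.
by rewrite cardsE.
Qed.

Lemma kd_chains (A : nat -> {vspace D}) (x : 'I_n -> 'End(D)) i k c :
  (forall l v, v \in A k -> x l v \in A k.+1) ->
  c \in chains A i.+1 k -> kd x c \in chains A i k.+1.
Proof.
move=> xA /chainsP cC; apply/chainsP=> T; rewrite kdE.
have card_T (l : 'I_n) : l \notin T -> #|l |: T| = #|T|.+1 by move=> lT; rewrite cardsU1 lT.
case: eqP => [cT|ncT].
  apply: rpred_sum => l lT; apply: memvZ; apply: xA.
  by have := cC (l |: T); rewrite card_T // cT eqxx.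
rewrite big1 // => l lT; have := cC (l |: T); rewrite card_T // eqSS.
by case: eqP => [//|_ /eqP->]; rewrite linear0 scaler0.
Qed.

Lemma kd_chains0 (A : nat -> {vspace D}) x k c : c \in chains A 0 k -> kd x c = 0.
Proof.
move=> /chainsP cC; apply/ffunP=> T; rewrite kdE ffunE big1 // => l lT.
by have := cC (l |: T); rewrite cardsU1 lT add1n /= => /eqP->; rewrite linear0 scaler0.
Qed.

Definition krank (A : nat -> {vspace D}) x i k := \dim (kd x @: chains A i k).

Lemma krank_ker (A : nat -> {vspace D}) x i k :
  (\dim (chains A i k :&: lker (kd x)) + krank A x i k)%N = ('C(n, i) * \dim (A k))%N.
Proof. by rewrite limg_ker_dim dim_chains. Qed.

Lemma krank0 (A : nat -> {vspace D}) x k : krank A x 0 k = 0%N.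
Proof.
apply/eqP; rewrite dimv_eq0 -subv0; apply/subvP=> _ /memv_imgP[c cC ->].
by rewrite (kd_chains0 _ cC) mem0v.
Qed.

End Koszul.

(** * Invariance of Koszul ranks under a linear change of variables *)

Section KoszulTransvection.
Variables (K : fieldType) (D : vectType K) (n : nat).
Local Notation E := {ffun {set 'I_n} -> D}.

(** Contraction with the dual vector of e_k; [kwedge q] is left multiplication by e_q. The
    differential is the sum of the [x k] applied to these contractions, and the relations below are
    those of the Clifford algebra. *)
Definition kcontr (k : 'I_n) (c : E) : E :=
  [ffun T : {set 'I_n} => if k \in T then 0 else ksgn K k T *: c (k |: T)].

Definition kwedge (q : 'I_n) (c : E) : E :=
  [ffun T : {set 'I_n} => if q \in T then ksgn K q (T :\ q) *: c (T :\ q) else 0].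

Lemma kd_contr x (c : E) (T : {set 'I_n}) : kd x c T = \sum_k x k (kcontr k c T).
Proof.
rewrite kdE [LHS]big_mkcond; apply: eq_bigr => k _; rewrite ffunE.
by case: (k \in T); rewrite ?linear0 ?linearZ.
Qed.

Lemma kcontr_wedge k q (c : E) : k != q -> kcontr k (kwedge q c) = - kwedge q (kcontr k c).
Proof.
move=> kq; apply/ffunP=> T; rewrite !ffunE !inE kq.
have [kT|kT] /= := boolP (k \in T).
  by case: ifP; rewrite ?scaler0 ?oppr0.
have [qT|qT] := boolP (q \in T); last by rewrite orbF [q == k]eq_sym (negPf kq) scaler0 oppr0.
rewrite orbT !scalerA.
set T0 := T :\ q; have q0 : q \notin T0 by rewrite !inE eqxx.
have k0 : k \notin T0 by rewrite !inE (negPf kT) andbF.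
have -> : T = q |: T0 by rewrite setD1K.
have -> : (k |: (q |: T0)) :\ q = k |: T0.
  apply/setP=> j; rewrite !inE; have [->|] //= := eqVneq j q.
  by rewrite eq_sym (negPf kq).
rewrite !ksgnU1 // -scaleNr; congr (_ *: _).
have : (q < k)%N != (k < q)%N by move: kq; rewrite -val_eqE /=; lia.
by case: (q < k)%N; case: (k < q)%N => // _; ring.
Qed.

Lemma kcontr_wedge_same q (c : E) : kcontr q (kwedge q c) + kwedge q (kcontr q c) = c.
Proof.
apply/ffunP=> T; rewrite !ffunE; have [qT|qT] := boolP (q \in T).
  by rewrite add0r !inE eqxx /= scalerA ksgn_sq scale1r setD1K.
by rewrite addr0 !inE eqxx /= setU1K // scalerA ksgn_sq scale1r.
Qed.

Lemma kcontr_anti j k (c : E) : kcontr j (kcontr k c) = - kcontr k (kcontr j c).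
Proof.
apply/ffunP=> T; rewrite !ffunE !inE.
have [jT|jT] /= := boolP (j \in T).
  by rewrite orbT scaler0; case: ifP; rewrite oppr0.
have [kT|kT] /= := boolP (k \in T); first by rewrite orbT scaler0 oppr0.
rewrite !orbF [j == k]eq_sym; have [->|kj] := eqVneq k j; first by rewrite scaler0 oppr0.
rewrite !scalerA !ksgnU1 // -scaleNr setUCA; congr (_ *: _).
have : (k < j)%N != (j < k)%N by move: kj; rewrite -val_eqE /=; lia.
by case: (k < j)%N; case: (j < k)%N => // _; ring.
Qed.

(* The action on the exterior algebra of the substitution x_p := x_p + b x_q. *)
Definition ktransv (b : K) p q (c : E) : E := c - b *: kwedge q (kcontr p c).

Fact ktransv_linear b p q : linear (ktransv b p q).
Proof.
move=> a u v; apply/ffunP=> T; rewrite !ffunE !inE.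
case: ifP => _; last by rewrite !scaler0 !subr0.
case: ifP => _; first by rewrite !scaler0 !subr0.
set s := ksgn _ _ _; set t := ksgn _ _ _.
rewrite scalerBr !scalerDr !scalerA opprD addrACA; congr (_ - _ *: _ + _).
by rewrite mulrC !mulrA.
Qed.
HB.instance Definition _ b p q :=
  GRing.isLinear.Build K E E _ (ktransv b p q) (ktransv_linear b p q).

(** Let N be [kwedge q] after [kcontr p]. The commutator of [kd x] with N is [x q] applied to
    [kcontr p], and [kd y] exceeds [kd x] by b times the same operator, so the terms in b cancel;
    the term in b^2 vanishes because [kcontr p] kills the image of N. *)
Lemma kd_transv b p q (x y : 'I_n -> 'End(D)) (c : E) : p != q ->
  y p = x p + b *: x q -> (forall k, k != p -> y k = x k) ->
  kd y (ktransv b p q c) = ktransv b p q (kd x c).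
Proof.
move=> pq yp yk.
pose N c := kwedge q (kcontr p c).
have NE (c' : E) (T : {set 'I_n}) : N c' T =
   if (q \in T) && (p \notin T) then
     (ksgn K q (T :\ q) * ksgn K p (T :\ q)) *: c' (p |: (T :\ q)) else 0.
  rewrite !ffunE !inE pq /=; case: (q \in T) => //=.
  by case: (p \in T); rewrite ?scaler0 // scalerA.
have contrN k : kcontr k (N c) = (if k == q then kcontr p c else 0) + N (kcontr k c).
  have [->|kq] := eqVneq k q.
    rewrite -[LHS](addrK (kwedge q (kcontr q (kcontr p c)))) kcontr_wedge_same.
    by rewrite kcontr_anti; congr (_ + _); apply/ffunP=> T; rewrite !ffunE; case: ifP;
      rewrite ?oppr0 // scalerN opprK.
  rewrite kcontr_wedge // kcontr_anti add0r; apply/ffunP=> T; rewrite !ffunE.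
  by case: ifP; rewrite ?oppr0 // scalerN opprK.
have kdN : kd x (N c) = N (kd x c) + [ffun T => x q (kcontr p c T)].
  apply/ffunP=> T; rewrite kd_contr [RHS]ffunE [X in _ + X]ffunE addrC.
  under eq_bigr => k _ do rewrite contrN ffunE linearD /=.
  rewrite big_split /= (bigD1 q) //= eqxx big1 ?addr0; last first.
    by move=> k /negPf->; rewrite ffunE linear0.
  congr (_ + _); rewrite NE kd_contr.
  case: ifP => H; last by rewrite big1 // => k _; rewrite NE H linear0.
  by rewrite scaler_sumr; apply: eq_bigr => k _; rewrite NE H linearZ.
have kdy c' : kd y c' = kd x c' + b *: [ffun T => x q (kcontr p c' T)].
  apply/ffunP=> T; rewrite kd_contr !ffunE kd_contr [LHS](bigD1 p) //= [X in _ = X + _](bigD1 p) //=.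
  rewrite yp add_lfunE scale_lfunE -!addrA; congr (_ + _).
  rewrite addrC; congr (_ + _); first by apply: eq_bigr => k kp; rewrite yk.
  by rewrite !ffunE.
have contr_pN : kcontr p (N c) = 0.
  rewrite contrN (negPf pq) add0r; apply/ffunP=> T; rewrite NE [RHS]ffunE.
  by case: ifP => // _; rewrite ffunE setU11 scaler0.
have -> : ktransv b p q (kd x c) = kd x c - b *: N (kd x c) by [].
have -> : ktransv b p q c = c - b *: N c by [].
rewrite kdy.
have -> : [ffun T => x q (kcontr p (c - b *: N c) T)] = [ffun T => x q (kcontr p c T)] :> E.
  apply/ffunP=> T; rewrite !ffunE.
  have := congr1 (fun c : E => c T) contr_pN; rewrite !ffunE.
  case: ifP => // _ H; rewrite scalerBr scalerA [_ * b]mulrC -scalerA; congr (x q _).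
  by rewrite [X in b *: X]H scaler0 subr0.
rewrite linearB linearZ /= kdN.
by rewrite scalerDr opprD -!addrA addNr addr0.
Qed.

(** The transvection is injective and preserves chains, so it embeds the image of [kd x] in that of
    [kd y]; the transvection with - b gives the other inequality. *)
Lemma krank_transv A b p q (x y : 'I_n -> 'End(D)) i k : p != q ->
  y p = x p + b *: x q -> (forall k, k != p -> y k = x k) ->
  krank A x i k = krank A y i k.
Proof.
suff le b' (x' y' : 'I_n -> 'End(D)) : p != q -> y' p = x' p + b' *: x' q ->
    (forall k, k != p -> y' k = x' k) -> (krank A x' i k <= krank A y' i k)%N.
  move=> pq yp yk; apply/eqP; rewrite eqn_leq (le b) //= (le (- b)) //.
    by rewrite yp yk 1?eq_sym // scaleNr addrK.
  by move=> j /yk.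
move=> pq yp yk; pose t := linfun (ktransv b' p q).
have tE c : t c = ktransv b' p q c by rewrite lfunE.
have t_inj : lker t == 0%VS.
  rewrite -subv0; apply/subvP=> c; rewrite memv_ker memv0 tE subr_eq0 => /eqP cE.
  have pc : kcontr p c = 0.
    rewrite cE; apply/ffunP=> T; rewrite !ffunE.
    case: ifP => // pT; rewrite !inE pq eqxx /=.
    by case: ifP; rewrite ?scaler0.
  rewrite cE pc; apply/eqP/ffunP=> T; rewrite !ffunE.
  by case: ifP; rewrite !scaler0.
rewrite /krank -(@limg_dim_eq _ _ _ t (kd x' @: _)); last first.
  by apply/eqP; rewrite (eqP t_inj) capv0.
apply: dimvS; apply/subvP=> _ /memv_imgP[_ /memv_imgP[c cC ->] ->].
rewrite tE -(kd_transv c pq yp yk); apply: memv_img.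
apply/chainsP=> S; have /chainsP cP := cC.
rewrite !ffunE; have := cP S.
have cS' : q \in S -> p \notin S -> #|p |: S :\ q| = #|S|.
  by move=> qS pS; rewrite cardsU1 (cardsD1 q S) qS !inE (negPf pS) andbF.
have [qS|qS] := boolP (q \in S); last by rewrite scaler0 subr0.
have [pS|pS] := boolP (p \in S); first by rewrite !inE pq pS !scaler0 subr0.
rewrite !inE (negPf pS) andbF; have := cP (p |: S :\ q); rewrite cS' //.
case: ifP => _; first by move=> u v; rewrite memvB // !memvZ.
by move=> /eqP-> /eqP->; rewrite !scaler0 subr0.
Qed.
End KoszulTransvection.

(** * Koszul cycles when one variable acts injectively *)

Section KoszulKernel.
Variables (K : fieldType) (D : vectType K) (n : nat).
Local Notation E := {ffun {set 'I_n} -> D}.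

Definition krestr (p : 'I_n) (c : E) : E := [ffun S : {set 'I_n} => if p \in S then 0 else c S].

Fact krestr_linear p : linear (krestr p).
Proof. by move=> a u v; apply/ffunP=> S; rewrite !ffunE; case: ifP; rewrite ?scaler0 ?addr0. Qed.
HB.instance Definition _ p := GRing.isLinear.Build K E E _ (krestr p) (krestr_linear p).

(* A cycle c is determined by its restriction a to the sets avoiding p: on the sets
   containing p it is the image of - kd a under the left inverse g of x p, up to sign,
   and then the cycle condition on those sets reads kd x (kd (g o x) a) = 0. *)
Lemma dim_koszul_ker (A : nat -> {vspace D}) (x : 'I_n -> 'End(D)) (p : 'I_n) (g : 'End(D))
    (i k : nat) (U : {set 'I_n} -> {vspace D}) :
  (forall l v, v \in A k -> x l v \in A k.+1) ->
  (forall a, a \in A k -> g (x p a) = a) ->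
  (forall S : {set 'I_n}, (U S <= if (#|S| == i) && (p \notin S) then A k else 0)%VS) ->
  (forall (S : {set 'I_n}) j a, p \notin S -> j \in S -> a \in U S -> x j a \in (x p @: A k)%VS) ->
  (forall (S : {set 'I_n}) j l a, p \notin S -> j \in S -> l \in S -> j != l -> a \in U S ->
     x j (g (x l a)) = x l (g (x j a))) ->
  (forall c, c \in chains n A i k -> kd x c = 0 -> forall S : {set 'I_n}, p \notin S -> c S \in U S) ->
  \dim (chains n A i k :&: lker (kd x)) = (\sum_S \dim (U S))%N.
Proof.
move=> xA gx UA xU gU kerU; set Z := (_ :&: _)%VS.
have U0 (S : {set 'I_n}) a : a \in U S -> p \in S -> a = 0.
  by move=> aU pS; apply/eqP; have := subvP (UA S) _ aU; rewrite pS andbF memv0.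
have U1 (S : {set 'I_n}) a : a \in U S -> #|S| != i -> a = 0.
  by move=> aU /negPf Si; apply/eqP; have := subvP (UA S) _ aU; rewrite Si memv0.
have U2 (S : {set 'I_n}) a : a \in U S -> a \in A k.
  by move=> /(subvP (UA S)); case: ifP => // _; rewrite memv0 => /eqP->; apply: mem0v.
rewrite -dim_ffspace -(@limg_dim_eq _ _ _ (linfun (krestr p)) Z); last first.
  apply/eqP; rewrite -subv0; apply/subvP=> c /memv_capP[/memv_capP[cC]].
  rewrite !memv_ker memv0 (lfunE (krestr p)) => /eqP dc /eqP rc.
  have cS (S : {set 'I_n}) : p \notin S -> c S = 0.
    by move=> /negPf pS; have := congr1 (fun c : E => c S) rc; rewrite !ffunE pS.
  apply/eqP/ffunP=> S; rewrite ffunE; have [pS|/cS//] := boolP (p \in S).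
  (* Besides the p-term, the differential at [S :\ p] only involves sets without p, where [c] is
     zero. *)
  have := congr1 (fun c : E => c (S :\ p)) dc; rewrite kdE ffunE.
  rewrite (bigD1 p) ?inE ?eqxx //= big1 ?addr0; last first.
    move=> l /andP[_ lp]; rewrite cS ?linear0 ?scaler0 //.
    by rewrite !inE eqxx orbF eq_sym.
  rewrite setD1K // => /eqP; rewrite scaler_eq0 signr_eq0 /= => /eqP xc0.
  have cSA : c S \in A k.
    by have /chainsP H := cC; have := H S; case: ifP => // _ /eqP->; apply: mem0v.
  by rewrite -(gx _ cSA) xc0 linear0.
congr (\dim _); apply/eqP; rewrite eqEsubv; apply/andP; split.
  apply/subvP=> _ /memv_imgP[c /memv_capP[cC dc] ->]; move: dc; rewrite memv_ker => /eqP dc.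
  rewrite lfunE; apply/memv_ffspace=> S; rewrite ffunE; case: ifP => pS; first exact: mem0v.
  by apply: kerU => //; rewrite pS.
apply/subvP=> a /memv_ffspace aU.
have dxa (T : {set 'I_n}) : p \notin T -> kd x a T \in (x p @: A k)%VS.
  move=> pT; rewrite kdE; apply: rpred_sum => j jT; apply: memvZ.
  have [->|jp] := eqVneq j p; first by rewrite (U0 _ _ (aU _)) ?linear0 ?mem0v // setU11.
  by apply: (xU (j |: T)); rewrite ?setU11 // !inE negb_or eq_sym jp.
have dxa0 (T : {set 'I_n}) : #|T|.+1 != i -> kd x a T = 0.
  move=> Ti; rewrite kdE big1 // => j jT.
  by rewrite (U1 _ _ (aU _)) ?linear0 ?scaler0 // cardsU1 jT.
pose c : E := [ffun S : {set 'I_n} => if p \in S then - ksgn K p (S :\ p) *: g (kd x a (S :\ p)) else a S].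
have gdA (T : {set 'I_n}) : p \notin T -> g (kd x a T) \in A k.
  by move=> /dxa/memv_imgP[w wA ->]; rewrite gx.
have xg (T : {set 'I_n}) : p \notin T -> x p (g (kd x a T)) = kd x a T.
  by move=> /dxa/memv_imgP[w wA ->]; rewrite gx.
have cC : c \in chains n A i k.
  apply/chainsP=> S; rewrite ffunE; have [pS|pS] := boolP (p \in S).
    have p0 : p \notin S :\ p by rewrite !inE eqxx.
    case: ifP => Si; first by rewrite memvZ ?gdA.
    by rewrite dxa0 ?linear0 ?scaler0 //; move: Si; rewrite (cardsD1 p) pS => ->.
  by case: ifP => Si; [exact: U2 (aU S) | rewrite (U1 _ _ (aU S)) ?Si].
apply/memv_imgP; exists c; last first.
  rewrite lfunE; apply/ffunP=> S; rewrite !ffunE; case: ifP => // pS.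
    exact: U0 (aU S) pS.
  by rewrite pS.
rewrite /Z; apply/memv_capP; split=> //; rewrite memv_ker; apply/eqP/ffunP=> T; rewrite [RHS]ffunE.
have [pT|pT] := boolP (p \in T); last first.
  rewrite kdE (bigD1 p) //= ffunE setU11 linearZ /= setU1K // scalerA mulrN ksgn_sq scaleN1r.
  rewrite xg // {1}kdE (bigD1 p) //= (U0 _ _ (aU _)) ?setU11 // linear0 scaler0 add0r.
  apply/eqP; rewrite addrC subr_eq0; apply/eqP; apply: eq_bigr => j /andP[jT jp].
  by rewrite ffunE !inE (negPf pT) eq_sym (negPf jp).
set T0 := T :\ p; have p0 : p \notin T0 by rewrite !inE eqxx.
pose y j : 'End(D) := (g \o x j)%VF.
have kdy S : kd y a S = g (kd x a S).
  by rewrite !kdE linear_sum; apply: eq_bigr => j _; rewrite linearZ /= comp_lfunE.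
have /(congr1 (fun c : E => c T0)) : kd x (kd y a) = 0.
  apply: kd_comp0 => S j l jS lS jl; rewrite !comp_lfunE.
  have [pS|pS] := boolP (p \in S); last exact: gU (aU S).
  by rewrite (U0 _ _ (aU S) pS) !linear0.
rewrite kdE ffunE (bigD1 p) //= {1}kdE big1 ?linear0 ?scaler0 ?add0r; last first.
  move=> j jT; rewrite (U0 _ _ (aU _)) ?linear0 ?scaler0 //.
  by rewrite !inE eqxx orbT.
move=> H; transitivity (ksgn K p T0 *: (0 : D)); last by rewrite scaler0.
rewrite -{}H scaler_sumr kdE; apply: eq_big => [j|j jT].
  by rewrite !inE; case: eqVneq => [->|_]; rewrite ?pT // andbT.
have jp : j != p by apply: contraNneq jT => ->.
have jT0 : j \notin T0 by rewrite !inE (negPf jT) andbF.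
have -> : T = p |: T0 by rewrite setD1K.
rewrite ffunE !inE eqxx orbT.
have -> : (j |: (p |: T0)) :\ p = j |: T0.
  by rewrite setUCA setU1K // !inE negb_or eq_sym jp ?eqxx.
rewrite kdy linearZ /= !scalerA !ksgnU1 //; congr (_ *: _).
have : (p < j)%N != (j < p)%N by move: jp; rewrite -val_eqE /=; lia.
by case: (p < j)%N; case: (j < p)%N => // _; ring.
Qed.
End KoszulKernel.

(** * Duality of Koszul ranks under a nondegenerate pairing *)

Section KoszulDuality.
Variables (K : fieldType) (D : vectType K) (n : nat).
Local Notation E := {ffun {set 'I_n} -> D}.

(** The number of inversions of the sequence listing S and then its complement, each in increasing
    order: the sign (-1)^([kinv S]) compares e_S e_(~: S) with the standard top form. *)
Definition kinv (S : {set 'I_n}) : nat :=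
  \sum_(s in S) #|[set t : 'I_n | (t \notin S) && (t < s)%N]|.

(** Passing from T to [j |: T] gains the inversions (j, t) with t < j outside, and loses those (s,
    j) with s in T above j. *)
Lemma kinvU1 j (T : {set 'I_n}) : j \notin T ->
  (kinv T + #|[set l in ~: (j |: T) | (l < j)%N]| =
   kinv (j |: T) + #|[set s in T | (j < s)%N]|)%N.
Proof.
move=> jT; rewrite /kinv big_setU1 //= addnC.
have -> : [set l in ~: (j |: T) | (l < j)%N] = [set t | (t \notin j |: T) && (t < j)%N].
  by apply/setP=> t; rewrite !inE.
rewrite -addnA; congr addn.
have -> : #|[set s in T | (j < s)%N]| = (\sum_(s in T) (j < s)%N)%N.
  rewrite -sum1_card big_mkcond [RHS]big_mkcond; apply: eq_bigr => s _.
  by rewrite inE; case: (s \in T); case: (j < s)%N.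
rewrite -big_split /=; apply: eq_bigr => s sT.
have -> : [set t | (t \notin T) && (t < s)%N] =
   if (j < s)%N then j |: [set t | (t \notin j |: T) && (t < s)%N]
   else [set t | (t \notin j |: T) && (t < s)%N].
  apply/setP=> t; case: ifP => js; rewrite !inE negb_or; have [->|_] //= := eqVneq t j;
   by rewrite ?js ?jT.
by case: ifP => _; rewrite ?addn0 // cardsU1 !inE eqxx /= addnC.
Qed.

(** The elements of T below j and above j together make up T, which turns the count of inversions
    into the sign (-1)^#|T|. *)
Lemma kinv_sign j (T : {set 'I_n}) : j \notin T ->
  (-1) ^+ kinv T * ksgn K j T =
  (-1) ^+ #|T| * ((-1) ^+ kinv (j |: T) * ksgn K j (~: (j |: T))).
Proof.
move=> jT; have := kinvU1 jT; rewrite /ksgn -!exprD.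
set a := #|[set l in ~: _ | _]|; set b := #|[set s in T | (j < _)%N]|.
set c := #|[set l in T | _]| => e.
have cT : #|T| = (c + b)%N.
  rewrite -(cardsID [set s : 'I_n | (s < j)%N] T); congr (_ + _)%N; apply: eq_card => s.
    by rewrite !inE.
  rewrite !inE -leqNgt andbC; have [->|sj] := eqVneq s j; first by rewrite (negPf jT).
  by rewrite [(j < s)%N]ltn_neqAle eq_sym val_eqE sj.
by rewrite -signr_odd -[RHS]signr_odd; congr (_ ^+ nat_of_bool _); lia.
Qed.

Variable pr : 'Hom(D, 'Hom(D, K^o)).

(* The pairing of complementary exterior powers, with the sign of the shuffle (S, ~: S). *)
Definition kpair (a b : E) : K :=
  \sum_S (-1) ^+ kinv S * (pr (a S) (b (~: S)) : K).

Fact kpair_linear a : linear (kpair a : E -> K^o).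
Proof.
move=> s u v; rewrite /kpair -[RHS]/(s * (\sum_S _) + \sum_S _) mulr_sumr -big_split /=.
by apply: eq_bigr => S _; rewrite !ffunE linearP /= mulrDr mulrCA.
Qed.
HB.instance Definition _ a :=
  GRing.isLinear.Build K E K^o _ (kpair a : E -> K^o) (kpair_linear a).

Lemma kpair_sum (r : nat) (s : 'I_r -> K) (a : 'I_r -> E) b :
  kpair (\sum_i s i *: a i) b = \sum_i s i * kpair (a i) b.
Proof.
rewrite [RHS](eq_bigr _ (fun i _ => mulr_sumr _ _ _ _)).
rewrite exchange_big; apply: eq_bigr => S _ /=.
rewrite sum_ffunE linear_sum sum_lfunE mulr_sumr; apply: eq_bigr => i _ /=.
by rewrite ffunE linearZ scale_lfunE /= mulrCA.
Qed.

(** The terms match under S = [j |: T]. The sign depends only on the size of T, which is i wherever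
    [a] does not vanish. *)
Lemma kpair_adj (A : nat -> {vspace D}) (x : 'I_n -> 'End(D)) i m k l (a b : E) :
  (forall j u v, u \in A k -> v \in A l -> pr (x j u) v = pr u (x j v)) ->
  a \in chains n A i.+1 k -> b \in chains n A m l ->
  kpair (kd x a) b = (-1) ^+ i * kpair a (kd x b).
Proof.
move=> prx /chainsP aC /chainsP bC; rewrite /kpair mulr_sumr.
have bA S : b S \in A l.
  by have := bC S; case: ifP => // _ /eqP->; apply: mem0v.
have aA S : a S \in A k.
  by have := aC S; case: ifP => // _ /eqP->; apply: mem0v.
transitivity (\sum_(j : 'I_n) \sum_(T : {set 'I_n} | j \notin T)
    (-1) ^+ kinv T * (ksgn K j T * pr (x j (a (j |: T))) (b (~: T)) : K)).
  rewrite (exchange_big_dep xpredT) //=; apply: eq_bigr => T _.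
  rewrite kdE linear_sum sum_lfunE mulr_sumr; apply: eq_bigr => j _.
  by rewrite linearZ scale_lfunE.
transitivity (\sum_(j : 'I_n) \sum_(S : {set 'I_n} | j \in S)
    (-1) ^+ i * ((-1) ^+ kinv S * (ksgn K j (~: S) * pr (a S) (x j (b (j |: ~: S))) : K)));
  last first.
  rewrite (exchange_big_dep xpredT) //=; apply: eq_bigr => S _.
  rewrite kdE linear_sum !mulr_sumr; apply: eq_big => [j|j _]; first by rewrite inE negbK.
  by rewrite linearZ.
apply: eq_bigr => j _.
rewrite [RHS](reindex_onto (fun T => j |: T) (fun S => S :\ j)) /=; last first.
  by move=> S jS; rewrite setD1K.
apply: eq_big => [T|T jT].
  rewrite setU11 /=; apply/idP/eqP => [jT|<-]; first by rewrite setU1K.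
  by rewrite !inE eqxx.
have -> : j |: ~: (j |: T) = ~: T.
  by apply/setP=> t; rewrite !inE; have [->|] := eqVneq t j.
rewrite prx //; have := aC (j |: T); rewrite cardsU1 jT eqSS.
case: eqP => [<- _|_ /eqP->]; last by rewrite linear0 zero_lfunE !mulr0.
by rewrite !mulrA kinv_sign // !mulrA.
Qed.

(** If b pairs to zero with a basis of the image of [kd x] on the first chains, then by adjointness
    every such chain pairs to zero with [kd x b], which is therefore 0. So the kernel on the second
    chains is cut out by at most as many equations as that image has dimensions. *)
Lemma krank_dual_le (A : nat -> {vspace D}) (x : 'I_n -> 'End(D)) i m k l :
  (i + m).+1 = n ->
  (forall j u v, u \in A k -> v \in A l -> pr (x j u) v = pr u (x j v)) ->
  (forall j v, v \in A l -> x j v \in A l.+1) ->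
  (forall v, v \in A l.+1 -> (forall u, u \in A k -> pr u v = 0) -> v = 0) ->
  (krank A x m.+1 l <= krank A x i.+1 k)%N.
Proof.
move=> imn prx xA nondeg; rewrite {2}/krank.
set V := (kd x @: _)%VS; pose r := \dim V.
pose f (b : E) : {ffun 'I_r -> K^o} := [ffun j : 'I_r => kpair (vbasis V)`_j b].
have f_linear : linear f.
  by move=> s u v; apply/ffunP=> j; rewrite !ffunE linearP.
pose fL := GRing.isLinear.Build K E {ffun 'I_r -> K^o} _ f f_linear.
pose F : {linear E -> {ffun 'I_r -> K^o}} := HB.pack f fL.
have kerF : (chains n A m.+1 l :&: lker (linfun F) <= chains n A m.+1 l :&: lker (kd x))%VS.
  apply/subvP=> b /memv_capP[bC]; rewrite memv_ker lfunE => /eqP fb.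
  apply/memv_capP; split=> //; rewrite memv_ker; apply/eqP.
  have bV a : a \in V -> kpair a b = 0.
    move=> /coord_vbasis->; rewrite kpair_sum big1 // => j _.
    have := congr1 (fun c : {ffun 'I_r -> K^o} => c j) fb; rewrite !ffunE => ->.
    by rewrite mulr0.
  have dbC := kd_chains (k := l) xA bC.
  have pr0 (a : E) : a \in chains n A i.+1 k -> kpair a (kd x b) = 0.
    move=> aC; have := bV _ (memv_img (kd x) aC); rewrite (kpair_adj prx aC bC).
    by move/eqP; rewrite mulf_eq0 signr_eq0 /= => /eqP.
  apply/ffunP=> T; rewrite [RHS]ffunE.
  have /chainsP/(_ T) := dbC; case: eqP => [cT dbT|_ /eqP//].
  apply: nondeg => // u uA.
  (* A chain concentrated on the complement of T isolates the component of [kd x b] at T. *)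
  have := pr0 (ffdelta (~: T) u).
  rewrite /kpair (bigD1 (~: T)) //= big1 ?addr0; last first.
    by move=> S /negPf ST; rewrite ffunE ST linear0 zero_lfunE mulr0.
  rewrite ffunE eqxx setCK => H.
  suff C : ffdelta (~: T) u \in chains n A i.+1 k.
    by have /eqP := H C; rewrite mulf_eq0 signr_eq0 /= => /eqP.
  apply/chainsP=> S; rewrite ffunE; case: (eqVneq S (~: T)) => [->|_].
    have := cardsC T; rewrite card_ord cT => cTn.
    by have -> : #|~: T| == i.+1 by apply/eqP; lia.
  by case: ifP; rewrite ?mem0v.
have := krank_ker A x m.+1 l; have := limg_ker_dim (linfun F) (chains n A m.+1 l).
have := dimvS kerF; rewrite dim_chains.
have : (\dim (linfun F @: chains n A m.+1 l) <= r)%N.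
  apply: leq_trans (dimvS (subvf _)) _.
  by rewrite dimvf /dim /= card_ord muln1.
move=> h1 h2 h3 h4; rewrite -(leq_add2l (\dim (chains n A m.+1 l :&: lker (kd x)))) h4 -h3.
exact: leq_add h2 h1.
Qed.
End KoszulDuality.

(** * Linear forms acting on the algebra of a Perazzo form *)

Lemma dim_ker_bound (K : fieldType) (D D' : vectType K) (f : 'Hom(D, D'))
    (U : {vspace D}) (W : {vspace D'}) :
  (forall v, v \in U -> f v \in W) -> (\dim U <= \dim (U :&: lker f) + \dim W)%N.
Proof.
move=> fW; rewrite -(limg_ker_dim f U) leq_add2l; apply: dimvS.
by apply/subvP=> _ /memv_imgP[v vU ->]; apply: fW.
Qed.

Lemma dim_limg_inj (K : fieldType) (D D' : vectType K) (f : 'Hom(D, D')) (U : {vspace D}) :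
  (forall v, v \in U -> f v = 0 -> v = 0) -> \dim (f @: U) = \dim U.
Proof.
move=> inj; apply: limg_dim_eq; apply/eqP; rewrite -subv0; apply/subvP=> v.
by rewrite memv_cap memv_ker memv0 => /andP[vU /eqP /(inj _ vU) ->].
Qed.

Definition ix : 'I_5 := @Ordinal 5 0 isT.
Definition iy : 'I_5 := @Ordinal 5 1 isT.
Definition iz : 'I_5 := @Ordinal 5 2 isT.
Definition iu : 'I_5 := @Ordinal 5 3 isT.
Definition iv : 'I_5 := @Ordinal 5 4 isT.

Lemma ord5_case (i : 'I_5) : [\/ (i < 3)%N, i = iu | i = iv].
Proof.
case: i => [[|[|[|[|[|//]]]]]] lt_i.
- by constructor 1.
- by constructor 1.
- by constructor 1.
- by constructor 2; apply: val_inj.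
- by constructor 3; apply: val_inj.
Qed.

(* The components of A_F = R.F as abstract spaces: A k stands for the k-th graded
   component, w for F, x for the five variables, and pr (g.F) (h.F) for the constant
   coefficient of (gh).F. *)
Record perazzo_model (K : fieldType) (D : vectType K) (x : 'I_5 -> 'End(D))
    (A : nat -> {vspace D}) (w : D) (pr : 'Hom(D, 'Hom(D, K^o))) (d : nat) : Prop := {
  pm_comm : forall i j v, x i (x j v) = x j (x i v);
  pm_zero : A 0 = <[w]>%VS;
  pm_gen : forall k, A k.+1 = (\sum_j x j @: A k)%VS;
  pm_prx : forall j k l a b, a \in A k -> b \in A l -> pr (x j a) b = pr a (x j b);
  pm_prC : forall k l a b, a \in A k -> b \in A l -> pr a b = pr b a;
  pm_nondeg : forall k b, (k <= d)%N -> b \in A k ->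
    (forall a, a \in A (d - k)%N -> pr a b = 0) -> b = 0;
  pm_dim : forall k, (k <= d)%N -> \dim (A k) = min_hilb d k;
  pm_top : forall k, (d < k)%N -> A k = 0%VS;
  pm_sq : forall i j : 'I_5, (i < 3)%N -> (j < 3)%N -> x i (x j w) = 0 }.

Section PerazzoModel.
Variables (K : fieldType) (D : vectType K) (x : 'I_5 -> 'End(D)).
Variables (A : nat -> {vspace D}) (w : D) (pr : 'Hom(D, 'Hom(D, K^o))) (d : nat).
Hypotheses (char0 : [pchar K] =i pred0) (d5 : (5 <= d)%N).
Hypothesis (PM : perazzo_model x A w pr d).

Let comm := pm_comm PM.

Lemma pm_deg j k v : v \in A k -> x j v \in A k.+1.
Proof.
move=> vA; rewrite (pm_gen PM); apply: (subvP (sumv_sup j _ (subvv _))) => //.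
exact: memv_img.
Qed.

(** Every element of A_(d-k) is a sum of multiples of variables, and the pairing moves a variable to
    the other side, where it kills b. *)
Lemma pm_socle k b : (k < d)%N -> b \in A k -> (forall j, x j b = 0) -> b = 0.
Proof.
move=> kd bA xb; apply: (pm_nondeg PM (ltnW kd) bA) => a.
have -> : (d - k = (d - k.+1).+1)%N by lia.
rewrite (pm_gen PM) => /memv_sumP[f fA ->]; rewrite linear_sum sum_lfunE big1 // => j _.
by have /memv_imgP[c cA ->] := fA j isT; rewrite (pm_prx PM j cA bA) xb linear0.
Qed.

Definition killed k f := f \in A k /\ forall i : 'I_5, (i < 3)%N -> x i f = 0.

Lemma killed_x j k f : killed k f -> killed k.+1 (x j f).
Proof. by case=> fA xf; split=> [|i i3]; [exact: pm_deg | rewrite comm xf // linear0]. Qed.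

Lemma killed_comb a b k f g : killed k f -> killed k g -> killed k (a *: f + b *: g).
Proof.
move=> [fA xf] [gA xg]; split=> [|i i3]; first by rewrite memvD ?memvZ.
by rewrite linearD !linearZ /= xf // xg // !scaler0 addr0.
Qed.

Lemma killed_socle k f : (k < d)%N -> killed k f -> x iu f = 0 -> x iv f = 0 -> f = 0.
Proof.
by move=> kd [fA xf] uf vf; apply: pm_socle fA _ => // j; case: (ord5_case j) => [/xf//|->|->].
Qed.

(* With J = (x, y, z)A: J1 is J_1, and M1 is (u, v)J_1. *)
Definition J1 : {vspace D} := (<[x ix w]> + <[x iy w]> + <[x iz w]>)%VS.
Definition M1 : {vspace D} := (x iu @: J1 + x iv @: J1)%VS.

Lemma wA0 : w \in A 0. Proof. by rewrite (pm_zero PM) memv_line. Qed.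

Lemma mem_J1 (i : 'I_5) : (i < 3)%N -> x i w \in J1.
Proof.
case: i => [[|[|[|//]]]] lt_i _.
- apply: (subvP (addvSl _ _)); apply: (subvP (addvSl _ _)).
  by rewrite (_ : Ordinal _ = ix) ?memv_line //; apply: val_inj.
- apply: (subvP (addvSl _ _)); apply: (subvP (addvSr _ _)).
  by rewrite (_ : Ordinal _ = iy) ?memv_line //; apply: val_inj.
apply: (subvP (addvSr _ _)).
by rewrite (_ : Ordinal _ = iz) ?memv_line //; apply: val_inj.
Qed.

Lemma J1_ind (P : D -> Prop) : (forall a b f g, P f -> P g -> P (a *: f + b *: g)) ->
  (forall i : 'I_5, (i < 3)%N -> P (x i w)) -> forall f, f \in J1 -> P f.
Proof.
move=> PD Px f /memv_addP[_ /memv_addP[_ /vlineP[a ->] [_ /vlineP[b ->] ->]]].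
move=> [_ /vlineP[c ->] ->]; rewrite -[X in X + _]scale1r; apply: (PD) (Px iz isT).
by apply: PD; apply: Px.
Qed.

Lemma J1_killed f : f \in J1 -> killed 1 f.
Proof.
apply: J1_ind => [a b g h|i i3]; first exact: killed_comb.
by split=> [|j j3]; [apply: pm_deg wA0 | apply: (pm_sq PM)].
Qed.

Lemma M1P m : reflect (exists f g, [/\ f \in J1, g \in J1 & m = x iu f + x iv g]) (m \in M1).
Proof.
apply: (iffP memv_addP) => [[_ /memv_imgP[f fJ ->] [_ /memv_imgP[g gJ ->] ->]]|].
  by exists f, g.
by case=> f [g [fJ gJ ->]]; exists (x iu f); rewrite ?memv_img //; exists (x iv g);
  rewrite ?memv_img.
Qed.

Lemma M1_killed m : m \in M1 -> killed 2 m.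
Proof.
case/M1P=> f [g [/J1_killed kf /J1_killed kg ->]].
rewrite -[x iu f]scale1r -[x iv g]scale1r; apply: killed_comb; exact: killed_x.
Qed.

Lemma M1_J1 f : f \in J1 -> x iu f \in M1 /\ x iv f \in M1.
Proof.
move=> fJ; split; apply/M1P.
  by exists f, 0; rewrite mem0v linear0 addr0.
by exists 0, f; rewrite mem0v linear0 add0r.
Qed.

Lemma A1_lines : A 1 = (\sum_j <[x j w]>)%VS.
Proof.
by rewrite (pm_gen PM) (pm_zero PM); apply: eq_bigr => j _; rewrite limg_line.
Qed.

Lemma A1E : A 1 = (J1 + <[x iu w]> + <[x iv w]>)%VS.
Proof.
apply/eqP; rewrite eqEsubv A1_lines; apply/andP; split.
  apply/subv_sumP => j _; rewrite -memvE; case: (ord5_case j) => [j3|->|->].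
  - by apply: (subvP (addvSl _ _)); apply: (subvP (addvSl _ _)); apply: mem_J1.
  - by apply: (subvP (addvSl _ _)); apply: (subvP (addvSr _ _)); apply: memv_line.
  - by apply: (subvP (addvSr _ _)); apply: memv_line.
by rewrite /J1 !subv_add; do ?[apply/andP; split]; apply: (sumv_sup _ _ (subvv _)).
Qed.

Lemma dim_A1 : \dim (A 1) = 5%N.
Proof. by rewrite (pm_dim PM) //; lia. Qed.

Lemma dim_line_le (v : D) : (\dim <[v]> <= 1)%N.
Proof. by rewrite dim_vline; case: (v != 0). Qed.

Lemma dim_add_le (U V : {vspace D}) : (\dim (U + V) <= \dim U + \dim V)%N.
Proof. exact: dimv_add_leqif. Qed.

Lemma dim_J1 : (3 <= \dim J1)%N.
Proof.
have := dim_add_le (J1 + <[x iu w]>) <[x iv w]>; rewrite -A1E dim_A1.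
have := dim_add_le J1 <[x iu w]>.
have := dim_line_le (x iu w); have := dim_line_le (x iv w); lia.
Qed.

Lemma min_hilb_mid k : (2 <= k <= d - 2)%N -> min_hilb d k = 6%N.
Proof. by rewrite /min_hilb => ?; do !case: ifP; lia. Qed.

Lemma min_hilb_top : min_hilb d d = 1%N.
Proof. by rewrite /min_hilb; do !case: ifP; lia. Qed.

(** * Quadrics in u and v acting on J_1 *)

Section Quadrics.
Variables (y z : 'End(D)) (a b : K).
Hypothesis yz : forall v, y (z v) = z (y v).
Hypothesis (killed_y : forall k f, killed k f -> killed k.+1 (y f)).
Hypothesis (killed_z : forall k f, killed k f -> killed k.+1 (z f)).
Hypothesis yz_socle : forall k f, (k < d)%N -> killed k f -> y f = 0 -> z f = 0 -> f = 0.

(** The relation reduces all forms of degree m + 1 applied to f to z^(m+1) f and y z^m f. The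
    induction hypothesis applies to z f and gives z f = 0; then y f is killed by both y and z, hence
    is 0. *)
Lemma quadric_zero m k f : (k + m.+1 = d)%N -> killed k f ->
  y (y f) = a *: y (z f) + b *: z (z f) ->
  iter m.+1 z f = 0 -> y (iter m z f) = 0 -> f = 0.
Proof.
elim: m k f => [|m IH] k f kd kf yyf zf yzf.
  by apply: yz_socle kf _ _ => //; lia.
have zf0 : z f = 0.
  apply: (IH k.+1); first lia.
  - exact: killed_z.
  - by rewrite !yz yyf linearD !linearZ /= yz.
  - by rewrite -iterSr.
  - by rewrite -iterSr.
have yf0 : y f = 0.
  apply: (yz_socle _ (killed_y kf)); first lia.
    by rewrite yyf zf0 ?linear0 ?scaler0 addr0.
  by rewrite -yz zf0 linear0.
by apply: yz_socle kf _ _ => //; lia.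
Qed.

(* Otherwise f in J_1 is determined by the scalars z^(d-1) f and y z^(d-2) f. *)
Lemma no_quadric : ~ forall f, f \in J1 -> y (y f) = a *: y (z f) + b *: z (z f).
Proof.
move=> yyJ.
pose zp m : 'End(D) := iter m (fun h => (z \o h)%VF) \1%VF.
have zpE m v : zp m v = iter m z v.
  by elim: m => [|m IH] /=; rewrite ?id_lfunE // comp_lfunE IH.
have kzp m f : f \in J1 -> killed m.+1 (zp m f).
  move=> fJ; rewrite zpE; elim: m => [|m IH] /=; first exact: J1_killed.
  exact: killed_z.
have dA m : m.+1 = d -> \dim (A m.+1) = 1%N.
  by move=> ->; rewrite (pm_dim PM) // min_hilb_top.
set N := (J1 :&: lker (zp d.-1))%VS; pose q : 'End(D) := (y \o zp (d - 2)%N)%VF.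
have b1 : (\dim J1 <= \dim N + \dim (A d.-1.+1))%N.
  by apply: dim_ker_bound => v /(kzp d.-1)[].
have b2 : (\dim N <= \dim (N :&: lker q) + \dim (A (d - 2).+2))%N.
  apply: dim_ker_bound => v /memv_capP[vJ _]; rewrite comp_lfunE.
  by have [] := killed_y (kzp (d - 2)%N v vJ).
have N0 : (N :&: lker q = 0)%VS.
  apply/eqP; rewrite -subv0; apply/subvP=> f /memv_capP[/memv_capP[fJ]].
  rewrite !memv_ker comp_lfunE !zpE memv0 => /eqP zf /eqP yzf; apply/eqP.
  apply: (@quadric_zero (d - 2) 1 f); rewrite ?yyJ //; first lia.
    exact: J1_killed.
  by have <- : d.-1 = (d - 2).+1 by lia.
have := dim_J1; move: b1 b2; rewrite N0 dimv0 (_ : (d - 2).+2 = d.-1.+1) ?dA; lia.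
Qed.
End Quadrics.

(** In one of three coordinate systems a nonzero quadric is monic in one variable, which is the
    shape excluded by [no_quadric]. *)
Lemma quadric_inj a b c :
  (forall f, f \in J1 -> a *: x iu (x iu f) + b *: x iu (x iv f) + c *: x iv (x iv f) = 0) ->
  [/\ a = 0, b = 0 & c = 0].
Proof.
have sym k f : (k < d)%N -> killed k f -> x iv f = 0 -> x iu f = 0 -> f = 0.
  by move=> kd kf vf uf; apply: killed_socle kd kf uf vf.
move=> H; have [a0|a0] := eqVneq a 0; last first.
  case: (@no_quadric (x iu) (x iv) (- (b / a)) (- (c / a))) => //.
  - by move=> k f; apply: killed_x.
  - by move=> k f; apply: killed_x.
  - exact: killed_socle.
  move=> f /H; rewrite -addrA => /eqP; rewrite addr_eq0 => /eqP/(congr1 ( *:%R a^-1)).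
  by rewrite scalerA mulVf // scale1r scalerN scalerDr !scalerA opprD !scaleNr ![a^-1 * _]mulrC.
have [c0|c0] := eqVneq c 0; last first.
  case: (@no_quadric (x iv) (x iu) (- (b / c)) 0) => //.
  - by move=> k f; apply: killed_x.
  - by move=> k f; apply: killed_x.
  move=> f /H; rewrite a0 scale0r add0r addr0 => /eqP; rewrite addrC addr_eq0.
  move=> /eqP/(congr1 ( *:%R c^-1)); rewrite scalerA mulVf // scale1r scalerN scalerA.
  by rewrite [c^-1 * _]mulrC scaleNr comm.
have [b0|b0] := eqVneq b 0; first by [].
(* Only the term uv is left; in the coordinates u and u + v, the relation uv = 0 becomes u^2 = u(u +
   v). *)
case: (@no_quadric (x iu) (x iu + x iv) 1 0) => //.
- by move=> v; rewrite !add_lfunE linearD /=; congr (_ + _); apply: comm.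
- by move=> k f; apply: killed_x.
- move=> k f kf; rewrite add_lfunE -[x iu f]scale1r -[x iv f]scale1r.
  by apply: killed_comb; apply: killed_x.
- move=> k f kd kf uf; rewrite add_lfunE uf add0r => vf; exact: killed_socle kd kf uf vf.
move=> f /H; rewrite a0 c0 !scale0r add0r !addr0 => /eqP; rewrite scaler_eq0 (negPf b0) /=.
by move=> /eqP uvf; rewrite scale1r add_lfunE linearD /= uvf addr0.
Qed.

(** [M1] is killed by x, y, z, so Q w in [M1] forces Q x_i w = x_i Q w = 0 for i < 3: the quadric Q
    kills J_1. *)
Lemma quadric_w_inj a b c :
  a *: x iu (x iu w) + b *: x iu (x iv w) + c *: x iv (x iv w) \in M1 ->
  [/\ a = 0, b = 0 & c = 0].
Proof.
pose Q : 'End(D) := a *: (x iu \o x iu)%VF + b *: (x iu \o x iv)%VF + c *: (x iv \o x iv)%VF.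
have QE f : Q f = a *: x iu (x iu f) + b *: x iu (x iv f) + c *: x iv (x iv f).
  by rewrite !(add_lfunE, scale_lfunE, comp_lfunE).
rewrite -QE => /M1_killed[_ xQ]; apply: quadric_inj => f fJ; rewrite -QE; move: f fJ.
apply: J1_ind => [s t f g Qf Qg|i i3]; first by rewrite linearD !linearZ /= Qf Qg !scaler0 addr0.
by rewrite -(xQ i i3) !QE !linearD !linearZ /= !(comm i).
Qed.

Lemma M1_le_A2 : (M1 <= A 2)%VS.
Proof. by apply/subvP=> m /M1_killed[]. Qed.

Lemma A2P a : a \in A 2 -> exists m r s t,
  m \in M1 /\ a = m + (r *: x iu (x iu w) + s *: x iu (x iv w) + t *: x iv (x iv w)).
Proof.
pose P a := exists m r s t,
  m \in M1 /\ a = m + (r *: x iu (x iu w) + s *: x iu (x iv w) + t *: x iv (x iv w)).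
have PD f g : P f -> P g -> P (f + g).
  move=> [m [r [s [t [mM ->]]]]] [m' [r' [s' [t' [mM' ->]]]]].
  exists (m + m'), (r + r'), (s + s'), (t + t'); split; first exact: memvD.
  rewrite addrACA !scalerDl; congr (_ + _).
  by rewrite [LHS]addrACA [X in X + _ = _]addrACA.
have PZ c f : P f -> P (c *: f).
  move=> [m [r [s [t [mM ->]]]]]; exists (c *: m), (c * r), (c * s), (c * t).
  by split; [exact: memvZ | rewrite !scalerDr !scalerA].
have P0 : P 0 by exists 0, 0, 0, 0; rewrite mem0v !scale0r !addr0.
have PM1 m : m \in M1 -> P m by exists m, 0, 0, 0; rewrite !scale0r !addr0.
have Pq i j : P (x i (x j w)).
  case: (ord5_case j) => [j3|->|->].
  - case: (ord5_case i) => [i3|->|->]; first by rewrite (pm_sq PM).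
      by apply: PM1; have [] := M1_J1 (mem_J1 j3).
    by apply: PM1; have [] := M1_J1 (mem_J1 j3).
  - case: (ord5_case i) => [i3|->|->].
    + by rewrite comm; apply: PM1; have [] := M1_J1 (mem_J1 i3).
    + by exists 0, 1, 0, 0; rewrite mem0v !scale0r !addr0 scale1r add0r.
    + by rewrite comm; exists 0, 0, 1, 0; rewrite mem0v !scale0r !addr0 scale1r !add0r.
  - case: (ord5_case i) => [i3|->|->].
    + by rewrite comm; apply: PM1; have [] := M1_J1 (mem_J1 i3).
    + by exists 0, 0, 1, 0; rewrite mem0v !scale0r !addr0 scale1r !add0r.
    + by exists 0, 0, 0, 1; rewrite mem0v !scale0r scale1r !add0r.
rewrite (pm_gen PM) => /memv_sumP[f fA ->]; apply: (big_ind P) => // i _.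
have /memv_imgP[v] := fA i isT; rewrite A1_lines => /memv_sumP[h hA ->] ->.
rewrite linear_sum; apply: (big_ind P) => // j _.
by have /vlineP[c ->] := hA j isT; rewrite linearZ /=; apply: PZ; apply: Pq.
Qed.

Lemma dim_A k : (2 <= k <= d - 2)%N -> \dim (A k) = 6%N.
Proof. by move=> k2; rewrite (pm_dim PM) ?min_hilb_mid //; lia. Qed.

(** The images of w under u^2, uv, v^2 are independent modulo [M1], which leaves 6 - 3
    dimensions. *)
Lemma dim_M1 : (\dim M1 <= 3)%N.
Proof.
pose X := [tuple x iu (x iu w); x iu (x iv w); x iv (x iv w)].
have XE (c : 'I_3 -> K) : \sum_(i < 3) c i *: X`_i =
    c 0 *: x iu (x iu w) + c 1 *: x iu (x iv w) + c 2%:R *: x iv (x iv w).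
  rewrite !big_ord_recl big_ord0 addr0 addrA.
  by congr (c _ *: _ + c _ *: _ + c _ *: _); apply: val_inj.
have c3 (c : 'I_3 -> K) : c 0 = 0 -> c 1 = 0 -> c 2%:R = 0 -> forall i, c i = 0.
  move=> c0 c1 c2 [[|[|[|//]]] lt_i].
  - by rewrite -[RHS]c0; congr c; apply: val_inj.
  - by rewrite -[RHS]c1; congr c; apply: val_inj.
  - by rewrite -[RHS]c2; congr c; apply: val_inj.
have freeX : free X.
  apply/freeP => c; rewrite XE => H; have [|h0 h1 h2] := @quadric_w_inj (c 0) (c 1) (c 2%:R).
    by rewrite H mem0v.
  exact: c3.
have capX : (M1 :&: <<X>> = 0)%VS.
  apply/eqP; rewrite -subv0; apply/subvP=> v /memv_capP[vM /coord_span vE].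
  move: vM; rewrite vE XE => /quadric_w_inj[h0 h1 h2].
  by rewrite h0 h1 h2 !scale0r !addr0 mem0v.
have : (\dim (M1 + <<X>>) <= \dim (A 2))%N.
  apply: dimvS; rewrite subv_add M1_le_A2; apply/span_subvP => v.
  by rewrite !inE => /or3P[]/eqP->; do 2!apply: pm_deg; apply: wA0.
rewrite dimv_disjoint_sum // dim_A; last lia.
by move: freeX; rewrite /free => /eqP->; rewrite /=; lia.
Qed.

(** Since u acts on f as a multiple of v, the elements v^2 f, v f and f are in turn killed by both u
    and v. Their degrees 4, 3, 2 lie below the socle degree d because d >= 5. *)
Lemma M1_cube f : f \in M1 -> forall b, x iu f = b *: x iv f -> x iv (x iv (x iv f)) = 0 -> f = 0.
Proof.
move=> /M1_killed kf b uf v3.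
have kill k g : (k < d)%N -> killed k g -> x iu g = b *: x iv g -> x iv g = 0 -> g = 0.
  by move=> kd kg ug vg; apply: (killed_socle kd kg _ vg); rewrite ug vg scaler0.
have v2 : x iv (x iv f) = 0.
  apply: (kill 4) => //; first by do 2!apply: killed_x.
  by rewrite !(comm iu iv) uf !linearZ.
have v1 : x iv f = 0.
  apply: (kill 3) => //; [lia | exact: killed_x | by rewrite (comm iu iv) uf linearZ].
by apply: (kill 2) => //; lia.
Qed.

(** * Choice of a linear form injective on (u, v)J_1 *)

Definition lform (b : K) : 'End(D) := x iu + b *: x iv.

Lemma lformE b v : lform b v = x iu v + b *: x iv v.
Proof. by rewrite add_lfunE scale_lfunE. Qed.

Lemma lform_ker b v : lform b v = 0 -> x iu v = - b *: x iv v.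
Proof. by rewrite lformE => /eqP; rewrite addr_eq0 scaleNr => /eqP. Qed.

Lemma lform_kerE b c v : lform b v = 0 -> lform c v = (c - b) *: x iv v.
Proof. by move=> /lform_ker uv; rewrite lformE uv -scalerDl addrC. Qed.

Lemma lformC b j v : lform b (x j v) = x j (lform b v).
Proof. by rewrite !lformE linearD linearZ /= !(comm j). Qed.

(* Apply the product of the other three forms: it maps f0 to a nonzero multiple of v^3 f0. *)
Lemma lform_indep b0 b1 b2 b3 a0 a1 a2 a3 f0 f1 f2 f3 :
  b1 != b0 -> b2 != b0 -> b3 != b0 -> f0 \in M1 -> f0 != 0 ->
  lform b0 f0 = 0 -> lform b1 f1 = 0 -> lform b2 f2 = 0 -> lform b3 f3 = 0 ->
  a0 *: f0 + (a1 *: f1 + (a2 *: f2 + a3 *: f3)) = 0 -> a0 = 0.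
Proof.
move=> b10 b20 b30 fM f0n0 l0 l1 l2 l3 S0.
have C b c v : lform b (lform c v) = lform c (lform b v).
  by rewrite (lformE c) (lformE c) linearD linearZ /= !lformC.
have := congr1 (fun v => lform b1 (lform b2 (lform b3 v))) S0.
have z1 : lform b1 (lform b2 (lform b3 f1)) = 0 by rewrite (C b1 b2) (C b1 b3) l1 !linear0.
have z2 : lform b1 (lform b2 (lform b3 f2)) = 0 by rewrite (C b2 b3) l2 !linear0.
rewrite !linear0 !linearD !linearZ /= z1 z2 l3 !linear0 ?scaler0 ?addr0.
rewrite (lform_kerE b3 l0) !linearZ /= (lform_kerE (b := b0) b2); last by rewrite lformC l0 linear0.
rewrite !linearZ /= (lform_kerE (b := b0) b1); last by rewrite !lformC l0 !linear0.
rewrite !scalerA => /eqP; rewrite scaler_eq0 => /orP[|/eqP v3].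
  by rewrite !mulf_eq0 !subr_eq0 (negPf b10) (negPf b20) (negPf b30) !orbF => /eqP.
by have := M1_cube fM (lform_ker l0) v3 => f00; rewrite f00 eqxx in f0n0.
Qed.

Lemma natr_inj4 (i j : 'I_4) : i != j -> (i%:R : K) != j%:R.
Proof.
move=> ij; wlog lt_ij : i j ij / (i < j)%N.
  move=> H; have [lt_ij|le_ji] := ltnP i j; first exact: H.
  rewrite eq_sym; apply: H; first by rewrite eq_sym.
  by rewrite ltn_neqAle le_ji val_eqE eq_sym ij.
rewrite eq_sym -subr_eq0 -natrB; last exact: ltnW.
by have [/(_ char0) -> _] := pcharf0P K; lia.
Qed.

(* Four kernel vectors of u, u + v, u + 2v, u + 3v would be independent in M1. *)
Lemma exists_lform : exists b, forall m, m \in M1 -> lform b m = 0 -> m = 0.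
Proof.
have [[i Hi]|H] := altP (@existsP _ (fun i : 'I_4 => (M1 :&: lker (lform i%:R) == 0)%VS)).
  exists i%:R => m mM lm; apply/eqP; rewrite -memv0 -(eqP Hi) memv_cap mM memv_ker.
  exact/eqP.
move: H; rewrite negb_exists => /forallP H.
pose f (i : 'I_4) := vpick (M1 :&: lker (lform i%:R))%VS.
have fP i : [/\ f i \in M1, f i != 0 & lform i%:R (f i) = 0].
  have /memv_capP[fM] := memv_pick (M1 :&: lker (lform i%:R))%VS.
  by rewrite memv_ker => /eqP lf; split; rewrite ?vpick0.
have freef : free [tuple f i | i < 4].
  apply/freeP => c.
  have -> : \sum_(i < 4) c i *: [tuple f i | i < 4]`_i = \sum_(i < 4) c i *: f i.
    by apply: eq_bigr => i _; rewrite -tnth_nth tnth_mktuple.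
  move=> S0 i.
  (* [lform_indep] controls only the first coefficient, so the four indices are permuted to put i
     first. *)
  have [s [si us]] : exists s : 4.-tuple 'I_4, [/\ tnth s ord0 = i & perm_eq s (enum 'I_4)].
    have sz : size (i :: rem i (enum 'I_4)) == 4.
      by rewrite /= size_rem ?mem_enum // size_enum_ord.
    by exists (Tuple sz); split=> //=; rewrite perm_sym perm_to_rem // mem_enum.
  move: S0; rewrite -big_enum /= -(perm_big _ us) /=.
  have := fP; move: us si; case/tupleP: s => s0 s; case/tupleP: s => s1 s.
  case/tupleP: s => s2 s; case/tupleP: s => s3 s; rewrite (tuple0 s) /= => us.
  have /= : uniq [:: s0; s1; s2; s3] by rewrite (perm_uniq us) enum_uniq.
  rewrite !inE !negb_or => /and4P[/and3P[n1 n2 n3] _ _ _] <- {}fP.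
  rewrite !big_cons big_nil addr0 => S0.
  have [[f0M f0 l0] [_ _ l1] [_ _ l2] [_ _ l3]] := And4 (fP s0) (fP s1) (fP s2) (fP s3).
  apply: lform_indep _ _ _ f0M f0 l0 l1 l2 l3 S0; by apply: natr_inj4; rewrite eq_sym.
have : (\dim <<[tuple f i | i < 4]>> <= \dim M1)%N.
  apply: dimvS; apply/span_subvP => v /tnthP[i ->]; rewrite tnth_mktuple.
  by have [] := fP i.
by move: freef; rewrite /free => /eqP->; rewrite size_tuple; have := dim_M1; lia.
Qed.

(** * Multiplication by the chosen form l *)

Section LinearForm.
Variable b : K.
Hypothesis l_inj_M1 : forall m, m \in M1 -> lform b m = 0 -> m = 0.
Local Notation l := (lform b).

Lemma lform_deg k v : v \in A k -> l v \in A k.+1.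
Proof. by move=> vA; rewrite lformE memvD ?memvZ ?pm_deg. Qed.

Lemma lform_img_le k : (l @: A k <= A k.+1)%VS.
Proof. by apply/subvP=> _ /memv_imgP[v vA ->]; apply: lform_deg. Qed.

Lemma l_inj_J1 f : f \in J1 -> l f = 0 -> f = 0.
Proof.
move=> fJ lf; have [uM vM] := M1_J1 fJ.
apply: (killed_socle _ (J1_killed fJ)); first lia.
  by apply: l_inj_M1 => //; rewrite lformC lf linear0.
by apply: l_inj_M1 => //; rewrite lformC lf linear0.
Qed.

(** By injectivity the image of J_1 has dimension at least 3, and [M1] has dimension at most 3. *)
Lemma l_J1 : (l @: J1)%VS = M1.
Proof.
apply/eqP; rewrite eqEdim; apply/andP; split.
  apply/subvP=> _ /memv_imgP[f fJ ->]; have [uM vM] := M1_J1 fJ.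
  by rewrite lformE memvD ?memvZ.
by rewrite (dim_limg_inj l_inj_J1); apply: leq_trans dim_M1 dim_J1.
Qed.

(** Write a = m + Q w with m in [M1]. Since x_i kills l a and m, the quadric Q kills every l x_i w,
    hence l J_1 = [M1]. So for f in J_1 the element Q f, of degree 3, is killed by u and v too and
    vanishes. Then Q = 0 and a = m lies in [M1], where l is injective. *)
Lemma l_inj_A2 a : a \in A 2 -> l a = 0 -> a = 0.
Proof.
move=> /A2P[m [r [s [t [mM ->]]]]].
pose Q : 'End(D) := r *: (x iu \o x iu)%VF + s *: (x iu \o x iv)%VF + t *: (x iv \o x iv)%VF.
have QE f : Q f = r *: x iu (x iu f) + s *: x iu (x iv f) + t *: x iv (x iv f).
  by rewrite !(add_lfunE, scale_lfunE, comp_lfunE).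
have Qx j f : Q (x j f) = x j (Q f).
  by rewrite !QE !linearD !linearZ /= !(comm j).
have Ql f : Q (l f) = l (Q f) by rewrite !lformE linearD linearZ /= !Qx.
have Qk k f : killed k f -> killed k.+2 (Q f).
  move=> kf; have kxx i j : killed k.+2 (x i (x j f)) by do 2!apply: killed_x.
  have := killed_comb 1 t (killed_comb r s (kxx iu iu) (kxx iu iv)) (kxx iv iv).
  by rewrite scale1r -QE.
rewrite -QE => la.
have QM1 m' : m' \in M1 -> Q m' = 0.
  rewrite -l_J1 => /memv_imgP[f fJ ->]; rewrite Ql; move: f fJ; apply: J1_ind => [c e f g Hf Hg|i i3].
    by rewrite !linearD !linearZ /= Hf Hg !scaler0 addr0.
  have := congr1 (x i) la; rewrite -lformC linearD Qx linear0 /=.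
  by have [_ /(_ i i3)->] := M1_killed mM; rewrite add0r.
have QJ1 f : f \in J1 -> Q f = 0.
  move=> fJ; have [uM vM] := M1_J1 fJ.
  apply: (killed_socle _ (Qk _ _ (J1_killed fJ))); first lia.
    by rewrite -Qx QM1.
  by rewrite -Qx QM1.
have [|r0 s0 t0] := @quadric_inj r s t; first by move=> f /QJ1; rewrite QE.
move: la; rewrite QE r0 s0 t0 !scale0r !addr0; exact: l_inj_M1.
Qed.

(** Injectivity on A_2 and dim A_2 = dim A_3 = 6 give the first case; it propagates because l
    commutes with the variables, which generate each degree from the previous one. *)
Lemma l_surj k : (2 <= k)%N -> A k.+1 = (l @: A k)%VS.
Proof.
case: k => [|[|k]] // _; elim: k => [|k IH].
  apply/esym/eqP; rewrite eqEdim lform_img_le (dim_limg_inj l_inj_A2).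
  by rewrite !dim_A //; lia.
rewrite (pm_gen PM) {1}IH [in RHS](pm_gen PM) limg_sum; apply: eq_bigr => j _.
by rewrite -!limg_comp; apply: eq_in_limg => v _; rewrite !comp_lfunE lformC.
Qed.

(** For 2 <= k <= d - 3 a surjection between spaces of dimension 6 is injective. In degree 1 the
    dimensions are 5 and 6, and duality is used: an element killed by l pairs to zero with l A_(d-2)
    = A_(d-1). *)
Lemma l_inj k v : (1 <= k <= d - 3)%N -> v \in A k -> l v = 0 -> v = 0.
Proof.
move=> kd vA lv; have [k1|k1] := eqVneq k 1.
  rewrite k1 in vA; apply: (pm_nondeg PM _ vA); first lia.
  have -> : (d - 1 = (d - 2).+1)%N by lia.
  move=> a; rewrite l_surj; last lia.
  move=> /memv_imgP[a' a'A ->]; rewrite lformE linearD linearZ add_lfunE scale_lfunE /=.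
  rewrite !(pm_prx PM _ a'A vA).
  by move: lv; rewrite lformE => /(congr1 (pr a')); rewrite linearD linearZ linear0.
apply/eqP; rewrite -memv0; have -> : 0%VS = (A k :&: lker l)%VS.
  apply/esym/eqP; rewrite -dimv_eq0.
  have := limg_ker_dim l (A k); rewrite -l_surj ?dim_A; lia.
by rewrite memv_cap vA memv_ker; apply/eqP.
Qed.

(** The hyperplane of those a in A_1 with v a in l A_1, as [v_A1'] and [v_A1'_conv] show. *)
Definition A1' : {vspace D} := (J1 + <[l w]>)%VS.

Lemma A1'_sub : (A1' <= A 1)%VS.
Proof.
rewrite subv_add -memvE lform_deg ?wA0 // andbT.
by apply/subvP=> f /J1_killed[].
Qed.

Lemma A1_split : A 1 = (A1' + <[x iv w]>)%VS.
Proof.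
apply/eqP; rewrite eqEsubv subv_add A1'_sub -memvE pm_deg ?wA0 //= andbT A1E.
apply/subvP=> _ /memv_addP[_ /memv_addP[f fJ [_ /vlineP[c ->] ->]] [_ /vlineP[e ->] ->]].
have -> : f + c *: x iu w + e *: x iv w = (f + c *: l w) + (e - c * b) *: x iv w.
  rewrite lformE scalerDr scalerA scalerBl !addrA.
  by rewrite [X in _ = X - _]addrAC addrK.
by apply: memv_add; rewrite ?memvZ ?memv_line //; apply: memv_add; rewrite ?memvZ ?memv_line.
Qed.

Lemma dim_A1' : \dim A1' = 4%N.
Proof.
have := dim_add_le A1' <[x iv w]>; rewrite -A1_split dim_A1; have := dim_line_le (x iv w).
have := dim_add_le J1 <[l w]>; rewrite -/A1'; have := dim_line_le (l w).
have : (\dim J1 <= 3)%N.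
  have := dim_add_le (<[x ix w]> + <[x iy w]>) <[x iz w]>; rewrite -/J1.
  have := dim_add_le <[x ix w]> <[x iy w]>.
  have := dim_line_le (x ix w); have := dim_line_le (x iy w); have := dim_line_le (x iz w); lia.
lia.
Qed.

Lemma M1_img m : m \in M1 -> m \in (l @: A 1)%VS.
Proof.
rewrite -l_J1 => /memv_imgP[f fJ ->]; apply: memv_img.
by have [] := J1_killed fJ.
Qed.

Lemma x_l_img j : x j (l w) \in (l @: A 1)%VS.
Proof. by rewrite -lformC memv_img // pm_deg ?wA0. Qed.

Lemma v_A1' a : a \in A1' -> x iv a \in (l @: A 1)%VS.
Proof.
move=> /memv_addP[f fJ [_ /vlineP[c ->] ->]]; rewrite linearD linearZ memvD ?memvZ ?x_l_img //.
by apply: M1_img; have [] := M1_J1 fJ.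
Qed.

Lemma x_A1 (j : 'I_5) a : (j < 3)%N -> a \in A 1 -> x j a \in (l @: A 1)%VS.
Proof.
move=> j3; rewrite {1}A1_split => /memv_addP[_ /memv_addP[f fJ [_ /vlineP[c ->] ->]]].
move=> [_ /vlineP[e ->] ->]; rewrite !linearD !linearZ /= !memvD ?memvZ ?x_l_img //.
  by have [_ ->] := J1_killed fJ; rewrite ?mem0v.
by rewrite comm; apply: M1_img; have [] := M1_J1 (mem_J1 j3).
Qed.

Lemma A2_split : A 2 = (l @: A 1 + <[x iv (x iv w)]>)%VS.
Proof.
apply/eqP; rewrite eqEsubv subv_add lform_img_le -memvE !pm_deg ?wA0 //= andbT.
rewrite {1}(pm_gen PM); apply/subv_sumP => j _; apply/subvP=> _ /memv_imgP[a aA ->].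
have L v : v \in (l @: A 1)%VS -> v \in (l @: A 1 + <[x iv (x iv w)]>)%VS.
  exact: (subvP (addvSl _ _)).
have V : x iv a \in (l @: A 1 + <[x iv (x iv w)]>)%VS.
  move: aA; rewrite {1}A1_split => /memv_addP[f fA [_ /vlineP[c ->] ->]].
  rewrite linearD linearZ /=; apply: memvD; [exact/L/v_A1' | apply: memvZ].
  by apply: (subvP (addvSr _ _)); apply: memv_line.
case: (ord5_case j) => [j3|->|-> //]; first by rewrite L ?x_A1.
by rewrite -[x iu a](addrK (b *: x iv a)) -lformE; apply: memvB; [exact/L/memv_img | exact: memvZ].
Qed.

(** Otherwise v^2 w would lie in l A_1, and A_2 = l A_1 would have dimension 5 instead of 6. *)
Lemma v_A1'_conv a : a \in A 1 -> x iv a \in (l @: A 1)%VS -> a \in A1'.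
Proof.
rewrite {1}A1_split => /memv_addP[f fA [_ /vlineP[c ->] ->]].
rewrite linearD linearZ /= => H.
have [->|c0] := eqVneq c 0; first by rewrite scale0r addr0.
have : x iv (x iv w) \in (l @: A 1)%VS.
  have := memvB H (v_A1' fA); rewrite addrC addKr => /(memvZ c^-1).
  by rewrite scalerA mulVf // scale1r.
rewrite memvE => /addv_idPl E; have := dim_A (k := 2); rewrite A2_split E.
rewrite (@dim_limg_inj _ _ _ l); last by move=> v; apply: l_inj; lia.
by rewrite dim_A1; lia.
Qed.

End LinearForm.
End PerazzoModel.

(** * Ranks of the Koszul differentials *)

Lemma lfun_left_inverse (K : fieldType) (D D' : vectType K) (f : 'Hom(D, D')) (U : {vspace D}) :
  (forall v, v \in U -> f v = 0 -> v = 0) ->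
  exists g : 'Hom(D', D), forall v, v \in U -> g (f v) = v.
Proof.
move=> inj; pose h := (f \o projv U)%VF.
exists (projv U \o h^-1)%VF => v vU; rewrite comp_lfunE.
have fv : f v = h v by rewrite comp_lfunE projv_id.
have : h (h^-1%VF (f v)) = f v.
  by apply: limg_lfunVK; rewrite fv memv_img ?memvf.
rewrite comp_lfunE => H; apply/eqP; rewrite -subr_eq0; apply/eqP/inj.
  by rewrite memvB ?memv_proj.
by rewrite linearB /= H subrr.
Qed.

Lemma card_draws_disjoint (T : finType) (B : {set T}) i :
  #|[set S : {set T} | (#|S| == i) && [disjoint S & B]]| = 'C(#|~: B|, i).
Proof.
rewrite -cards_draws; apply: eq_card => S; rewrite !inE andbC; congr (_ && _).
by rewrite -setI_eq0 setI_eq0 disjoints_subset.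
Qed.

Section KoszulRanks.
Variables (K : fieldType) (D : vectType K) (x : 'I_5 -> 'End(D)).
Variables (A : nat -> {vspace D}) (w : D) (pr : 'Hom(D, 'Hom(D, K^o))) (d : nat).
Hypotheses (char0 : [pchar K] =i pred0) (d5 : (5 <= d)%N).
Hypothesis (PM : perazzo_model x A w pr d).

Lemma card_avoid_u i : #|[set S : {set 'I_5} | (#|S| == i) && (iu \notin S)]| = 'C(4, i).
Proof.
have := card_draws_disjoint [set iu] i; rewrite cardsC1 card_ord => <-.
by apply: eq_card => S; rewrite !inE disjoint_sym disjoints1.
Qed.

Lemma card_avoid_uv i :
  #|[set S : {set 'I_5} | [&& #|S| == i, iu \notin S & iv \notin S]]| = 'C(3, i).
Proof.
have c2 : #|~: [set iu; iv]| = 3.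
  by have := cardsC [set iu; iv]; rewrite cards2 card_ord /=; lia.
have := card_draws_disjoint [set iu; iv] i; rewrite c2 => <-.
apply: eq_card => S; rewrite !inE; congr (_ && _).
rewrite disjoint_sym disjoints_subset; apply/andP/subsetP => [[uS vS] t|H].
  by rewrite !inE => /orP[]/eqP->.
by have := H iu; have := H iv; rewrite !inE !eqxx orbT => -> // ->.
Qed.

(** The five vectors x_k w are independent, so a cycle with coefficients in K w vanishes in positive
    homological degree: its coefficient at S appears next to x_j w in the condition at [S :\ j]. *)
Lemma krank_zeroth i : krank A x i.+1 0 = 'C(5, i.+1).
Proof.
have dA0 : \dim (A 0) = 1%N by rewrite (pm_dim PM).
have := krank_ker A x i.+1 0; rewrite dA0 muln1 => <-.
suff -> : (chains 5 A i.+1 0 :&: lker (kd x) = 0)%VS by rewrite dimv0.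
apply/eqP; rewrite -subv0; apply/subvP=> c /memv_capP[/chainsP cC].
rewrite memv_ker memv0 => /eqP dc.
have line_c S : exists a, c S = a *: w.
  have := cC S; case: ifP => _; first by rewrite (pm_zero PM) => /vlineP.
  by move=> /eqP->; exists 0; rewrite scale0r.
have [lam lamE] := fin_all_exists line_c.
apply/eqP/ffunP=> S; rewrite ffunE; have := cC S; case: eqP => [cS _|_ /eqP//].
have [j jS] : exists j, j \in S by apply/set0Pn; rewrite -card_gt0 cS.
pose X := [tuple x k w | k < 5].
have freeX : free X.
  apply: (basis_free (U := A 1)); rewrite basisEdim size_tuple (dim_A1 d5 PM) leqnn andbT.
  rewrite (A1_lines PM); apply/subv_sumP => k _; rewrite -memvE memv_span //.
  by apply/tnthP; exists k; rewrite tnth_mktuple.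
have := congr1 (fun c : {ffun {set 'I_5} -> D} => c (S :\ j)) dc; rewrite kdE ffunE.
rewrite big_mkcond /= => H.
have /freeP/(_ (fun k => if k \notin S :\ j then ksgn K k (S :\ j) * lam (k |: S :\ j) else 0)) := freeX.
move=> /(_ _ j); rewrite !inE eqxx /= setD1K // => F.
have /eqP : ksgn K j (S :\ j) * lam S = 0.
  apply: F; rewrite -[RHS]H; apply: eq_bigr => k _.
  rewrite (nth_map k) ?size_enum_ord // nth_ord_enum; case: ifP => _; last by rewrite scale0r.
  by rewrite lamE linearZ scalerA.
by rewrite mulf_eq0 signr_eq0 /= lamE => /eqP->; rewrite scale0r.
Qed.

(** The sum is 6 and not 5 because the differential from homological degree i to i - 1 is dual to
    the one from 6 - i to 5 - i. *)
Lemma krank_dual i j k l : (0 < i)%N -> (0 < j)%N -> (i + j = 6)%N -> (k + l).+1 = d ->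
  krank A x i k = krank A x j l.
Proof.
suff le i' j' k' l' : (0 < i')%N -> (0 < j')%N -> (i' + j' = 6)%N -> (k' + l').+1 = d ->
    (krank A x i' k' <= krank A x j' l')%N.
  move=> i0 j0 ij kl; apply/eqP; rewrite eqn_leq; apply/andP; split; apply: le => //; lia.
case: i' j' => [//|i'] [//|j'] _ _ ij kl.
apply: (@krank_dual_le _ _ _ pr A x j' i' l' k'); first lia.
- by move=> t u v uA vA; apply: (pm_prx PM) uA vA.
- by move=> t v; apply: (pm_deg PM).
- move=> v vA H; apply: (pm_nondeg PM _ vA); first lia.
  by have -> : (d - k'.+1)%N = l' by lia.
Qed.

Lemma krank_large i k : (d <= k)%N -> krank A x i k = 0%N.
Proof.
move=> dk; case: i => [|i]; first exact: krank0.
apply/eqP; rewrite dimv_eq0 -subv0; apply/subvP=> _ /memv_imgP[c cC ->].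
have /(_ i k.+1) := @dim_chains _ _ 5 A; rewrite (pm_top PM) ?dimv0 ?muln0 //.
move=> /eqP; rewrite dimv_eq0 => /eqP <-.
by apply: kd_chains cC => j v; apply: (pm_deg PM).
Qed.

(** * Koszul ranks in coordinates containing l *)

Section LinearForm.
Variable b : K.
Hypothesis l_inj_M1 : forall m, m \in M1 x w -> lform x b m = 0 -> m = 0.
Local Notation l := (lform x b).

(* The variables after replacing u by l. *)
Let y (j : 'I_5) : 'End(D) := if j == iu then l else x j.

Let yu : y iu = l. Proof. by rewrite /y eqxx. Qed.
Let yx j : j != iu -> y j = x j. Proof. by rewrite /y => /negPf->. Qed.

Let y_deg j k v : v \in A k -> y j v \in A k.+1.
Proof. by move=> vA; rewrite /y; case: ifP => _; [apply: (lform_deg PM) | apply: (pm_deg PM)]. Qed.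

Let krank_y i k : krank A x i k = krank A y i k.
Proof. by apply: (@krank_transv _ _ _ A b iu iv). Qed.

Let yE (S : {set 'I_5}) j : iu \notin S -> j \in S -> y j = x j.
Proof. by move=> uS jS; rewrite yx //; apply: contraNneq uS => <-. Qed.

(** In the kernel, a set of size i avoiding u contributes dim [A1'] = 4 if it contains v and dim A_1
    = 5 otherwise: 4 for each such set, and one more for each that also avoids v. *)
Lemma krank_first i : (krank A x i 1 + (4 * 'C(4, i) + 'C(3, i)) = 5 * 'C(5, i))%N.
Proof.
have [|g gl] := @lfun_left_inverse _ _ _ l (A 1).
  by move=> v; apply: (l_inj d5 PM l_inj_M1); lia.
have [|g2 gl2] := @lfun_left_inverse _ _ _ l (A 2).
  by move=> v; apply: (l_inj d5 PM l_inj_M1); lia.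
rewrite krank_y; have := krank_ker A y i 1; rewrite (dim_A1 d5 PM) mulnC => <-.
pose U (S : {set 'I_5}) : {vspace D} :=
  if (#|S| == i) && (iu \notin S) then if iv \in S then A1' x w b else A 1 else 0%VS.
have UA1 (S : {set 'I_5}) a : iu \notin S -> a \in U S -> a \in A 1.
  rewrite /U => ->; rewrite andbT; case: ifP => _; last by rewrite memv0 => /eqP->; apply: mem0v.
  by case: ifP => // _; apply: subvP; apply: (A1'_sub PM b).
have xU (S : {set 'I_5}) j a : iu \notin S -> j \in S -> a \in U S -> x j a \in (l @: A 1)%VS.
  move=> uS jS aU; have aA := UA1 _ _ uS aU; case: (ord5_case j) => [j3|ju|jv].
  - exact: (x_A1 d5 PM l_inj_M1).
  - by rewrite -ju jS in uS.
  rewrite jv in jS *; move: aU; rewrite /U uS jS andbT.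
  case: ifP => _; last by rewrite memv0 => /eqP->; rewrite linear0 mem0v.
  exact: (v_A1' d5 PM l_inj_M1).
have -> : \dim (chains 5 A i 1 :&: lker (kd y)) = (\sum_S \dim (U S))%N.
  apply: (@dim_koszul_ker _ _ _ A y iu g).
  - by move=> j v; apply: y_deg.
  - by rewrite yu.
  - move=> S; rewrite /U; case: ifP => // _; case: ifP => // _; exact: (A1'_sub PM b).
  - by move=> S j a uS jS aU; rewrite yu (yE uS jS); apply: xU aU.
  - move=> S j t a uS jS tS jt aU; rewrite !(yE uS) //.
    have /memv_imgP[p pA xj] := xU S j a uS jS aU.
    have /memv_imgP[q qA xt] := xU S t a uS tS aU.
    (* As l is injective on A_2, both sides may be compared after applying l, where they become x_j
       x_t a and x_t x_j a. *)
    rewrite xj xt !gl // -[LHS]gl2 ?(pm_deg PM) // -[RHS]gl2 ?(pm_deg PM) //; congr (g2 _).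
    by rewrite !(lformC PM) -xj -xt (pm_comm PM).
  move=> c cC dc S uS; have /chainsP/(_ S) := cC; rewrite /U uS andbT.
  case: eqP => [cS cSA|_ /eqP->]; last exact: mem0v.
  case: ifP => vS //; apply: (v_A1'_conv d5 PM l_inj_M1) => //.
  (* In the cycle condition at [S :\ iv] every term except that of v lies in l A_1, so v c_S lies
     there too. *)
  have := congr1 (fun c : {ffun {set 'I_5} -> D} => c (S :\ iv)) dc.
  rewrite kdE ffunE (bigD1 iv) ?inE ?eqxx //= setD1K // => /eqP.
  rewrite addr_eq0 (yE uS vS) => /eqP H.
  rewrite -[x iv _]scale1r -(ksgn_sq K iv (S :\ iv)) -scalerA H.
  apply: memvZ; rewrite memvN; apply: rpred_sum => j /andP[jS jv]; apply: memvZ.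
  have cA T : c T \in A 1.
    by have /chainsP/(_ T) := cC; case: ifP => // _ /eqP->; apply: mem0v.
  case: (ord5_case j) => [j3|->|jv']; last by rewrite jv' eqxx in jv.
    by rewrite yx; [apply: (x_A1 d5 PM l_inj_M1) | apply: contraTneq j3 => ->].
  by rewrite yu memv_img.
rewrite addnC; congr addn; rewrite -card_avoid_u -card_avoid_uv.
rewrite -!sum1_card big_distrr /= big_mkcond [X in (_ + X)%N]big_mkcond -big_split /=.
apply: eq_bigr => S _; rewrite !inE /U; case: (#|S| == i); rewrite /= ?dimv0 //.
case: (iu \notin S); rewrite /= ?dimv0 //; case: (iv \in S); rewrite /= ?(dim_A1 d5 PM) //.
by rewrite (dim_A1' d5 PM b).
Qed.

(** Here l maps A_k bijectively onto A_{k+1}, so once the exchange identity [comm_g] holds the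
    components on sets avoiding u are arbitrary, and the kernel has dimension 6 C(4, i). *)
Lemma krank_mid i k : (2 <= k <= d - 3)%N ->
  (krank A x i k + 6 * 'C(4, i) = 6 * 'C(5, i))%N.
Proof.
move=> kbnd; have l_injk : forall v, v \in A k -> l v = 0 -> v = 0.
  by move=> v; apply: (l_inj d5 PM l_inj_M1); lia.
have [g gl] := lfun_left_inverse l_injk.
have dAk : \dim (A k) = 6%N by apply: (dim_A d5 PM); lia.
have Ak1 : A k.+1 = (l @: A k)%VS by apply: (l_surj d5 PM l_inj_M1); lia.
have lg a : a \in A k.+1 -> l (g a) = a.
  by rewrite Ak1 => /memv_imgP[c cA ->]; rewrite gl.
have gA a : a \in A k.+1 -> g a \in A k.
  by rewrite Ak1 => /memv_imgP[c cA ->]; rewrite gl.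
have deg := pm_deg PM.
(* For a = l c the left inverse cancels l, and both sides are x_j x_t c. *)
have comm_l j t a : a \in (l @: A k.-1)%VS -> x j (g (x t a)) = x t (g (x j a)).
  have k1 : k = k.-1.+1 by lia.
  move=> /memv_imgP[c cA ->]; rewrite -!(lformC PM) !gl; first exact: (pm_comm PM).
    by rewrite k1; apply: (deg).
  by rewrite k1; apply: (deg).
(* For k > 2 all of A_k is l A_{k-1}; in degree 2 only the class of v^2 w remains. *)
have comm_g j t a : a \in A k -> x j (g (x t a)) = x t (g (x j a)).
  move=> aA; have [k2|k2] := eqVneq k 2; last first.
    by apply: comm_l; rewrite -(l_surj d5 PM l_inj_M1) ?prednK //; lia.
  subst k; pose q := x iv (x iv w).
  have qA : q \in A 2 by do 2!apply: (deg); apply: (wA0 PM).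
  (* For d >= 6, apply the injective l; for d = 5, the form <x_j l^-1 x_t -, -> minus its
     transpose is alternating on A_2 and vanishes on the hyperplane l A_1. *)
  suff Hq : x j (g (x t q)) = x t (g (x j q)).
    move: aA; rewrite (A2_split d5 PM l_inj_M1) => /memv_addP[c cA [_ /vlineP[s ->] ->]].
    by rewrite !linearD /= (comm_l j t c cA) -/q !linearZ /= Hq.
  set p := g (x t q); set r := g (x j q).
  have pA : p \in A 2 by apply: gA; apply: (deg).
  have rA : r \in A 2 by apply: gA; apply: (deg).
  have lp : l p = x t q by apply: lg; apply: (deg).
  have lr : l r = x j q by apply: lg; apply: (deg).
  have zA : x j p - x t r \in A 3 by rewrite memvB ?deg.
  have lz : l (x j p - x t r) = 0.
    by rewrite linearB /= !(lformC PM) lp lr (pm_comm PM) subrr.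
  apply/eqP; rewrite -subr_eq0; apply/eqP; have [d6|d6] := ltnP 5 d.
    by apply: (l_inj d5 PM l_inj_M1 _ zA lz); lia.
  have d5' : d = 5 by lia.
  have prl m n u v : u \in A m -> v \in A n -> pr (l u) v = pr u (l v).
    move=> uA vA; rewrite !lformE linearD linearZ add_lfunE scale_lfunE !(pm_prx PM _ uA vA) /=.
    by rewrite linearD linearZ.
  apply: (pm_nondeg PM _ zA); first lia.
  rewrite d5' => a2; rewrite (A2_split d5 PM l_inj_M1).
  move=> /memv_addP[c /memv_imgP[e eA ->] [_ /vlineP[s ->] ->]].
  rewrite [pr (_ + _)]linearD linearZ /= add_lfunE scale_lfunE (prl _ _ _ _ eA zA) lz linear0 add0r -/q.
  rewrite linearB /= -(pm_prx PM j qA pA) -(pm_prx PM t qA rA) -lp -lr.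
  rewrite (prl _ _ _ _ rA pA) (prl _ _ _ _ pA rA).
  by rewrite (pm_prC PM rA (lform_deg PM b pA)) (prl _ _ _ _ pA rA) subrr scaler0.
rewrite krank_y; have := krank_ker A y i k; rewrite dAk mulnC => <-.
pose U (S : {set 'I_5}) : {vspace D} := if (#|S| == i) && (iu \notin S) then A k else 0%VS.
have UA S a : a \in U S -> a \in A k.
  by rewrite /U; case: ifP => // _; rewrite memv0 => /eqP->; apply: mem0v.
have -> : \dim (chains 5 A i k :&: lker (kd y)) = (\sum_S \dim (U S))%N.
  apply: (@dim_koszul_ker _ _ _ A y iu g).
  - by move=> j v; apply: y_deg.
  - by rewrite yu.
  - by move=> S.
  - by move=> S j a uS jS aU; rewrite yu -Ak1; apply: y_deg; apply: UA aU.
  - by move=> S j t a uS jS tS jt aU; rewrite !(yE uS) //; apply: comm_g; apply: UA aU.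
  move=> c cC dc S uS; have /chainsP/(_ S) := cC; rewrite /U uS andbT.
  by case: eqP => [//|_ /eqP->]; apply: mem0v.
rewrite addnC; congr addn; rewrite -card_avoid_u.
rewrite -!sum1_card big_distrr /= big_mkcond; apply: eq_bigr => S _.
by rewrite !inE /U; case: ifP => _; rewrite ?dimv0 ?dAk.
Qed.
End LinearForm.

End KoszulRanks.

(* The rows are C(5,i), 5 C(4,i-1) + C(3,i-1) and 6 C(4,i-1) for i > 0, followed by the
   first two read backwards (i replaced by 6 - i). *)
Definition krank_table (d i k : nat) : nat :=
  if k == 0%N then nth 0%N [:: 0; 5; 10; 10; 5; 1]%N i
  else if k == 1%N then nth 0%N [:: 0; 6; 23; 33; 21; 5]%N i
  else if (k <= d - 3)%N then nth 0%N [:: 0; 6; 24; 36; 24; 6]%N i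
  else if k == (d - 2)%N then nth 0%N [:: 0; 5; 21; 33; 23; 6]%N i
  else if k == d.-1 then nth 0%N [:: 0; 1; 5; 10; 10; 5]%N i
  else 0%N.

(** The dimension of the chains splits into homology, the rank leaving, and the rank arriving from
    homological degree i + 1 with coefficients in degree k - 1. *)
Lemma krank_table_betti d i k : (5 <= d)%N ->
  (betti_table d i (i + k) + krank_table d i k +
     (if k is k'.+1 then krank_table d i.+1 k' else 0) =
   'C(5, i) * (if (k <= d)%N then min_hilb d k else 0))%N.
Proof.
move=> d5; have [i5|i5] := ltnP 5 i.
  rewrite bin_small // mul0n.
  have tbl0 j l : (5 < j)%N -> krank_table d j l = 0%N.
    by move=> j5; rewrite /krank_table !nth_default //=; do !case: ifP.
  rewrite tbl0 // /betti_table; case: i i5 => [|[|[|[|[|[|i]]]]]] // i5.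
  by case: k => // k; rewrite tbl0.
have b0 : 'C(5, 0) = 1%N by []. have b1 : 'C(5, 1) = 5%N by [].
have b2 : 'C(5, 2) = 10%N by []. have b3 : 'C(5, 3) = 10%N by [].
have b4 : 'C(5, 4) = 5%N by []. have b5 : 'C(5, 5) = 1%N by [].
have [kd|kd] := leqP k d; last first.
  case: k kd => [//|k] kd; rewrite muln0 /krank_table /betti_table.
  case: i i5 => [|[|[|[|[|[|//]]]]]] _ /=; do !case: ifP; lia.
case: k kd => [|[|k]] kd.
- rewrite /krank_table /betti_table /min_hilb /=.
  case: i i5 => [|[|[|[|[|[|//]]]]]] _ /=; rewrite ?b0 ?b1 ?b2 ?b3 ?b4 ?b5; lia.
- rewrite /krank_table /betti_table /min_hilb /=.
  case: i i5 => [|[|[|[|[|[|//]]]]]] _ /=; rewrite ?b0 ?b1 ?b2 ?b3 ?b4 ?b5; lia.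
rewrite /krank_table /betti_table /min_hilb.
case: i i5 => [|[|[|[|[|[|//]]]]]] _ /=; rewrite ?b0 ?b1 ?b2 ?b3 ?b4 ?b5;
  do !case: ifP; lia.
Qed.

Section KoszulRankTable.
Variables (K : fieldType) (D : vectType K) (x : 'I_5 -> 'End(D)).
Variables (A : nat -> {vspace D}) (w : D) (pr : 'Hom(D, 'Hom(D, K^o))) (d : nat).
Hypotheses (char0 : [pchar K] =i pred0) (d5 : (5 <= d)%N).
Hypothesis (PM : perazzo_model x A w pr d).

Lemma krankE i k : krank A x i k = krank_table d i k.
Proof.
have [b l_inj_M1] := exists_lform char0 d5 PM.
have [i5|i5] := ltnP 5 i.
  rewrite /krank_table !nth_default //; have := krank_ker A x i k; rewrite bin_small // mul0n.
  by move=> H; do !case: ifP => _; lia.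
have r0 j : (j <= 5)%N -> krank A x j 0 = nth 0%N [:: 0; 5; 10; 10; 5; 1]%N j.
  case: j => [|j] j5; first by rewrite krank0.
  by rewrite (krank_zeroth d5 PM); move: j5; do 5 (case: j => [//|j]).
have r1 j : (j <= 5)%N -> krank A x j 1 = nth 0%N [:: 0; 6; 23; 33; 21; 5]%N j.
  move=> j5; apply: (@addIn (4 * 'C(4, j) + 'C(3, j))); rewrite (krank_first d5 PM l_inj_M1).
  by move: j5; do 6 (case: j => [//|j]).
rewrite /krank_table; have [->|k0] := eqVneq k 0%N; first exact: r0.
have [->|k1] := eqVneq k 1%N; first exact: r1.
case: ifP => km.
  apply: (@addIn (6 * 'C(4, i))); rewrite (krank_mid d5 PM l_inj_M1); last lia.
  by move: i5; do 6 (case: i => [//|i]).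
have [->|k2] := eqVneq k (d - 2)%N.
  case: i i5 => [|i] i5; first by rewrite krank0.
  rewrite (krank_dual d5 PM (j := 5 - i) (l := 1)) ?r1; try lia.
  by move: i5; do 5 (case: i => [//|i]).
have [->|k3] := eqVneq k d.-1.
  case: i i5 => [|i] i5; first by rewrite krank0.
  rewrite (krank_dual d5 PM (j := 5 - i) (l := 0)) ?r0; try lia.
  by move: i5; do 5 (case: i => [//|i]).
by apply: (krank_large PM); lia.
Qed.
End KoszulRankTable.

(** * The contraction action *)

Section Contraction.
Variable K : fieldType.
Local Notation P := {mpoly K[5]}.
Implicit Types (g h p F : P) (m : 'X_{1..5}).

(** A range of monomials independent of the support of g makes linearity in g a termwise check. *)
Lemma contractwE b g F : (msize g <= b)%N ->
  contract g F = \sum_(m : 'X_{1..5 < b}) g@_m *: F^`M[m].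
Proof.
move=> gb; pose I : subFinType _ := 'X_{1..5 < b}.
rewrite /contract (big_mksub I) //=; first last.
  by move=> m /msize_mdeg_lt/leq_trans; apply.
  by rewrite msupp_uniq.
by rewrite big_rmcond //= => m /memN_msupp_eq0 ->; rewrite scale0r.
Qed.

Definition contr F g : P := contract g F.

Fact contr_linear F : linear (contr F).
Proof.
move=> a g h; rewrite /contr; set b := maxn (msize (a *: g + h)) (maxn (msize g) (msize h)).
rewrite !(@contractwE b) ?leq_max ?leqnn ?orbT //.
rewrite scaler_sumr -big_split /=; apply: eq_bigr => m _.
by rewrite mcoeffD mcoeffZ scalerDl scalerA.
Qed.
HB.instance Definition _ F := GRing.isLinear.Build K P P _ (contr F) (contr_linear F).

Fact contract_linear g : linear (contract g).
Proof.
move=> a F H; rewrite /contract scaler_sumr -big_split /=; apply: eq_bigr => m _.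
by rewrite mderivmD mderivmZ scalerDr !scalerA [_ * a]mulrC.
Qed.
HB.instance Definition _ g := GRing.isLinear.Build K P P _ (contract g) (contract_linear g).

Lemma contrX F m : contr F 'X_[m] = F^`M[m].
Proof. by rewrite /contr /contract msuppX big_seq1 mcoeffX eqxx scale1r. Qed.

Lemma contrM F g h : contr F (g * h) = contr (contr F h) g.
Proof.
rewrite [X in contr F (X * _)](mpolyE g) [X in _ = contr _ X](mpolyE g) mulr_suml !linear_sum /=.
apply: eq_bigr => m _; rewrite -scalerAl !linearZ /= contrX; congr (_ *: _).
rewrite [X in contr F (_ * X)](mpolyE h) [X in _ = (contr F X)^`M[m]](mpolyE h) mulr_sumr.
rewrite [LHS]linear_sum [X in X^`M[m]]linear_sum [RHS]linear_sum /=; apply: eq_bigr => m' _.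
by rewrite -scalerAr -mpolyXD !linearZ /= !contrX addmC mderivmDm.
Qed.

Lemma contrXM F j g : contr F ('X_j * g) = (contr F g)^`M(j).
Proof. by rewrite contrM contrX mderivmU1m. Qed.

Lemma msize_leP b p : (forall m, (b <= mdeg m)%N -> p@_m = 0) -> (msize p <= b)%N.
Proof.
move=> H; rewrite msizeE; apply/bigmax_leqP_seq => m mp _; rewrite ltnNge.
by apply: contraTN mp => /H; rewrite mcoeff_msupp => ->; rewrite eqxx.
Qed.

Lemma homog_msize_le k p : p \is k.-homog -> (msize p <= k.+1)%N.
Proof.
move=> /dhomog_nemf_coeff ph; apply: msize_leP => m km; apply: ph.
by rewrite /= gtn_eqF.
Qed.

Lemma contr_coeff_deg d k F g m : F \is d.-homog -> g \is k.-homog ->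
  (contr F g)@_m != 0 -> (mdeg m + k)%N = d.
Proof.
move=> Fd gk; apply: contraNeq => mkd; rewrite /contr /contract raddf_sum big_seq big1 //= => m' m'g.
rewrite mcoeffZ mcoeff_mderivm (dhomog_nemf_coeff Fd) ?mul0rn ?mulr0 //=.
by rewrite mdegD (dhomog_mf gk m'g) addnC.
Qed.

Lemma contr_large d k F g : F \is d.-homog -> g \is k.-homog -> (d < k)%N -> contr F g = 0.
Proof.
move=> Fd gk dk; apply/mpolyP=> m; rewrite mcoeff0.
by apply: contraTeq dk => /(contr_coeff_deg Fd gk) <-; rewrite -leqNgt leq_addl.
Qed.

Lemma contr_msize d F g : F \is d.-homog -> (msize (contr F g) <= d.+1)%N.
Proof.
move=> Fd; apply: msize_leP => m dm; rewrite /contr /contract raddf_sum big1_seq //= => m' _.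
rewrite mcoeffZ mcoeff_mderivm (dhomog_nemf_coeff Fd) ?mul0rn ?mulr0 //=.
by rewrite mdegD; lia.
Qed.

Section Coordinates.
Variable b : nat.
Local Notation C := {ffun 'X_{1..5 < b} -> K^o}.

(** Monomials of degree b or more are dropped, so [mcomb] recovers only polynomials of size at most
    b. *)
Definition mcoords p : C := [ffun m : 'X_{1..5 < b} => p@_m].

Definition mcomb (f : C) : P := \sum_(m : 'X_{1..5 < b}) (f m : K) *: 'X_[m].

Fact mcoords_linear : linear mcoords.
Proof. by move=> a p q; apply/ffunP=> m; rewrite !ffunE mcoeffD mcoeffZ. Qed.
HB.instance Definition _ := GRing.isLinear.Build K P C _ mcoords mcoords_linear.

Fact mcomb_linear : linear mcomb.
Proof.
move=> a f g; rewrite /mcomb scaler_sumr -big_split /=; apply: eq_bigr => m _.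
by rewrite !ffunE scalerDl scalerA.
Qed.
HB.instance Definition _ := GRing.isLinear.Build K C P _ mcomb mcomb_linear.

Lemma mcoordsK p : (msize p <= b)%N -> mcomb (mcoords p) = p.
Proof.
by move=> pb; rewrite {2}(mpolywE pb); apply: eq_bigr => m _; rewrite ffunE.
Qed.

Lemma msize_mcomb f : (msize (mcomb f) <= b)%N.
Proof.
apply: msize_leP => m bm; rewrite /mcomb raddf_sum /= big1 // => m' _.
rewrite mcoeffZ mcoeffX; case: eqP => [e|]; last by rewrite mulr0.
by have := bmdeg m'; rewrite e ltnNge bm.
Qed.

Lemma mcoords_eq0 p : (msize p <= b)%N -> mcoords p = 0 -> p = 0.
Proof. by move=> pb /(congr1 mcomb); rewrite mcoordsK // linear0. Qed.
End Coordinates.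

Lemma msize_mderiv b j p : (msize p <= b)%N -> (msize p^`M(j) <= b)%N.
Proof.
move=> pb; apply: msize_leP => m bm; rewrite mcoeff_mderiv memN_msupp_eq0 ?mul0rn //.
by apply: msize_mdeg_ge; rewrite mdegD; lia.
Qed.
End Contraction.

Lemma perazzo_homog (K : fieldType) d (F : {mpoly K[5]}) : (0 < d)%N ->
  perazzo_form d F -> F \is d.-homog.
Proof.
move=> d0 [p0 [p1 [p2 [G [_ [[h0 h1 h2 hG] [_ ->]]]]]]].
have hv i p : p \is (d.-1).-homog -> var K i * p \is d.-homog.
  move=> hp; have <- : (1 + d.-1)%N = d by lia.
  by apply: dhomogM => //; rewrite dhomogX /= mdeg1.
by rewrite !rpredD ?hv.
Qed.

(** F has degree at most one in X, Y, Z jointly, since the p_i and G involve only U and V. *)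
Lemma perazzo_xx (K : fieldType) d (F : {mpoly K[5]}) (i j : 'I_5) :
  perazzo_form d F -> (i < 3)%N -> (j < 3)%N -> F^`M(j)^`M(i) = 0.
Proof.
move=> [p0 [p1 [p2 [G [[u0 u1 u2 uG] [_ [_ ->]]]]]]] i3 j3.
have ordI (k : 'I_5) : (k < 3)%N -> [\/ k = inord 0, k = inord 1 | k = inord 2].
  case: k => [[|[|[|//]]] lt_k] _; [constructor 1 | constructor 2 | constructor 3];
    by apply: val_inj; rewrite /= inordK.
have KUV0 (p : {mpoly K[5]}) (k : 'I_5) : in_KUV p -> (k < 3)%N -> p^`M(k) = 0.
  move=> pUV k3; rewrite /mderiv big_seq big1 // => m /pUV[m0 [m1 m2]].
  by case: (ordI k k3) => ->; rewrite ?m0 ?m1 ?m2 mul0r scale0r.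
have var_d n (p : {mpoly K[5]}) (k : 'I_5) : in_KUV p -> (k < 3)%N ->
    (var K n * p)^`M(k) = (inord n == k)%:R *: p.
  move=> pUV k3; rewrite mderivM (KUV0 p k) // mulr0 addr0 mderivX mnm1E.
  case: eqP => [->|_]; last by rewrite !scale0r mul0r.
  by rewrite !scale1r -[X in (X - _)%MM]add0m addmK mpolyX0 mul1r.
rewrite !mderivD (KUV0 G j) // mderiv0 addr0 !var_d // !mderivZ !KUV0 //.
by rewrite !scaler0 !addr0.
Qed.

(** * The algebra A_F as the space of derivatives of F *)

Section Model.
Variables (K : fieldType) (d : nat) (F : {mpoly K[5]}).
Hypotheses (char0 : [pchar K] =i pred0) (d5 : (5 <= d)%N).
Hypothesis (Fd : F \is d.-homog).
Local Notation P := {mpoly K[5]}.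
Local Notation D := {ffun 'X_{1..5 < d.+1} -> K^o}.
Local Notation ct := (contr F).

(* g.F in coordinates; A_F is modelled by the space of all g.F. *)
Definition apF (g : P) : D := mcoords d.+1 (ct g).

Fact apF_linear : linear apF.
Proof. by move=> a g h; rewrite /apF !linearP. Qed.
HB.instance Definition _ := GRing.isLinear.Build K P D _ apF apF_linear.

Lemma ct_msize g : (msize (ct g) <= d.+1)%N.
Proof. exact: contr_msize Fd. Qed.

Lemma apF_eq0 g : apF g = 0 -> ct g = 0.
Proof. by apply: mcoords_eq0; apply: ct_msize. Qed.

Definition xop_map (j : 'I_5) (f : D) : D := mcoords d.+1 (mcomb f)^`M(j).

Fact xop_map_linear j : linear (xop_map j).
Proof. by move=> a f g; rewrite /xop_map !linearP. Qed.
HB.instance Definition _ j := GRing.isLinear.Build K D D _ (xop_map j) (xop_map_linear j).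

Definition xop (j : 'I_5) : 'End(D) := linfun (xop_map j).

Lemma xopE j f : xop j f = mcoords d.+1 (mcomb f)^`M(j).
Proof. by rewrite lfunE. Qed.

Lemma xop_apF j g : xop j (apF g) = apF ('X_j * g).
Proof. by rewrite xopE mcoordsK ?ct_msize // /apF contrXM. Qed.

(** Projecting to the homogeneous part lets the source be a full coordinate space, so that the k-th
    component of A_F is the image of a linear map. *)
Definition comp_map k (f : {ffun 'X_{1..5 < k.+1} -> K^o}) : D := apF (pihomog mdeg k (mcomb f)).

Fact comp_map_linear k : linear (@comp_map k).
Proof. by move=> a f g; rewrite /comp_map !linearP. Qed.
HB.instance Definition _ k :=
  GRing.isLinear.Build K {ffun 'X_{1..5 < k.+1} -> K^o} D _ (@comp_map k) (@comp_map_linear k).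

Definition Acomp (k : nat) : {vspace D} := limg (linfun (@comp_map k)).

Lemma AcompP k v : reflect (exists2 g, g \is k.-homog & v = apF g) (v \in Acomp k).
Proof.
apply: (iffP memv_imgP) => [[f _ ->]|[g gk ->]].
  by rewrite lfunE; exists (pihomog mdeg k (mcomb f)); rewrite ?pihomogP.
exists (mcoords k.+1 g); first exact: memvf.
by rewrite lfunE /= /comp_map mcoordsK ?homog_msize_le // pihomog_dE.
Qed.

Lemma xop_comm i j v : xop i (xop j v) = xop j (xop i v).
Proof.
by rewrite !xopE !mcoordsK ?msize_mderiv ?msize_mcomb // mderiv_comm.
Qed.

Lemma Acomp0 : Acomp 0 = <[apF 1]>%VS.
Proof.
apply/vspaceP=> v; apply/AcompP/vlineP => [[g g0 ->]|[a ->]].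
  exists g@_0; rewrite -linearZ /= -[_ *: 1]mul_mpolyC mulr1.
  by rewrite -(msize1_polyC (homog_msize_le g0)).
by exists (a *: 1); rewrite ?linearZ // rpredZ // dhomog1.
Qed.

Lemma AcompS k : Acomp k.+1 = (\sum_j xop j @: Acomp k)%VS.
Proof.
apply/eqP; rewrite eqEsubv; apply/andP; split; last first.
  apply/subv_sumP => j _; apply/subvP=> _ /memv_imgP[_ /AcompP[g gk ->] ->].
  apply/AcompP; exists ('X_j * g); last by rewrite xop_apF.
  by apply: (dhomogM (d := 1)) => //; rewrite dhomogX /= mdeg1.
apply/subvP=> _ /AcompP[g gk ->].
rewrite [g]mpolyE linear_sum /= big_seq; apply: rpred_sum => m mg.
rewrite linearZ /= memvZ //; have := dhomog_mf gk mg => mk.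
have [j mj] : exists j, m j != 0%N.
  apply/existsP; apply: contraPT mk => /existsPn m0 /=.
  by rewrite mdegE big1 // => i _; apply/eqP; rewrite -[_ == _]negbK m0.
have mE : m = (U_(j) + (m - U_(j)))%MM.
  apply/mnmP=> i; rewrite mnmDE mnmBE mnm1E subnKC //.
  by case: eqP => // <-; rewrite lt0n.
have mj_k : ('X_[m - U_(j)] : P) \is k.-homog.
  by rewrite dhomogX; move: mk; rewrite {1}mE /= mdegD mdeg1 add1n => -[->].
rewrite mE mpolyXD -xop_apF.
apply: (subvP (sumv_sup j _ (subvv _))) => //; apply: memv_img.
by apply/AcompP; exists 'X_[m - U_(j)].
Qed.

Lemma Acomp_dim k n : hilb_eq F k n -> \dim (Acomp k) = n.
Proof.
case=> s [sk [sfree sspan]].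
pose X := [tuple apF (s i) | i < n].
have XE (a : 'I_n -> K) : \sum_(i < n) a i *: X`_i = apF (\sum_i a i *: s i).
  rewrite linear_sum; apply: eq_bigr => i _.
  by rewrite -tnth_nth tnth_mktuple linearZ.
have shom (a : 'I_n -> K) : \sum_i a i *: s i \is k.-homog.
  by apply: rpred_sum => i _; apply: rpredZ.
suff XB : basis_of (Acomp k) X by exact: vector.size_basis XB.
apply/andP; split; last first.
  apply/freeP => a; rewrite XE => H; apply: sfree; split=> //.
  exact: apF_eq0 H.
rewrite eqEsubv; apply/andP; split.
  apply/span_subvP => v /tnthP[i ->]; rewrite tnth_mktuple.
  by apply/AcompP; exists (s i).
apply/subvP=> _ /AcompP[g gk ->]; have [a [_ ga]] := sspan g gk.
have -> : apF g = \sum_(i < n) a i *: X`_i.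
  apply/eqP; rewrite XE -subr_eq0 -linearB /=; apply/eqP.
  by rewrite /apF (_ : ct _ = 0) ?linear0.
by apply: rpred_sum => i _; rewrite memvZ // memv_span // mem_nth ?size_tuple.
Qed.

Lemma Acomp_top k : (d < k)%N -> Acomp k = 0%VS.
Proof.
move=> dk; apply/eqP; rewrite -subv0; apply/subvP=> _ /AcompP[g gk ->].
by rewrite /apF (contr_large Fd gk dk) linear0 mem0v.
Qed.

Definition repr_map (f : D) : D := apF (mcomb f).

Fact repr_map_linear : linear repr_map.
Proof. by move=> a f g; rewrite /repr_map !linearP. Qed.
HB.instance Definition _ := GRing.isLinear.Build K D D _ repr_map repr_map_linear.

(* A polynomial g with g.F = f, for f of this form. *)
Definition lift (f : D) : P := mcomb ((linfun repr_map)^-1%VF f).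

(** The generalized inverse of [repr_map] returns a preimage whenever one exists. For k <= d the
    polynomial h is one, being recovered from its coordinates; for k > d both actions on F are
    zero. *)
Lemma ct_lift k h : h \is k.-homog -> ct (lift (apF h)) = ct h.
Proof.
move=> hk; have [hi hiE] : exists h', apF (mcomb (mcoords d.+1 h')) = apF h.
  have [dk|kd] := ltnP d k.
    exists 0; rewrite !linear0; apply/esym; rewrite /apF (contr_large Fd hk dk); exact: linear0.
  by exists h; rewrite mcoordsK // (leq_trans (homog_msize_le hk)).
have /limg_lfunVK : apF h \in limg (linfun repr_map).
  rewrite -hiE; apply/memv_imgP; exists (mcoords d.+1 hi); first exact: memvf.
  by rewrite lfunE.
rewrite lfunE /= /repr_map -/(lift _) => /(congr1 (@mcomb _ _)).
by rewrite !mcoordsK ?ct_msize.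
Qed.

Definition pr_map (a b : D) : K^o := (contr (mcomb a) (lift b))@_0.

Fact pr_map_linear a : linear (pr_map a).
Proof. by move=> s u v; rewrite /pr_map /lift !linearP. Qed.
HB.instance Definition _ a := GRing.isLinear.Build K D K^o _ (pr_map a) (pr_map_linear a).

Definition pr_fun (a : D) : 'Hom(D, K^o) := linfun (pr_map a).

Fact pr_fun_linear : linear pr_fun.
Proof.
move=> s a b; apply/lfunP=> v; rewrite add_lfunE scale_lfunE !lfunE /= /pr_map /contr.
by rewrite !linearP.
Qed.
HB.instance Definition _ := GRing.isLinear.Build K D 'Hom(D, K^o) _ pr_fun pr_fun_linear.

Definition prF : 'Hom(D, 'Hom(D, K^o)) := linfun pr_fun.

Lemma prFE l g h : h \is l.-homog -> prF (apF g) (apF h) = (ct (g * h))@_0.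
Proof.
move=> hl; rewrite !lfunE /= /pr_map mcoordsK ?ct_msize // -contrM mulrC contrM.
by rewrite [in LHS]contrM (ct_lift hl).
Qed.

Lemma XM_homog k j (g : P) : g \is k.-homog -> 'X_j * g \is (k.+1).-homog.
Proof. by move=> gk; apply: (dhomogM (d := 1)) => //; rewrite dhomogX /= mdeg1. Qed.

Lemma perazzo_form_model : perazzo_form d F ->
  (forall i, (i <= d)%N -> hilb_eq F i (min_hilb d i)) ->
  perazzo_model xop Acomp (apF 1) prF d.
Proof.
move=> Fform hilb; split.
- exact: xop_comm.
- exact: Acomp0.
- exact: AcompS.
- move=> j k l _ _ /AcompP[g gk ->] /AcompP[h hl ->].
  rewrite !xop_apF (prFE _ hl) (prFE _ (XM_homog j hl)).
  by rewrite mulrCA mulrA.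
- move=> k l _ _ /AcompP[g gk ->] /AcompP[h hl ->].
  by rewrite (prFE _ hl) (prFE _ gk) mulrC.
(* The pairing of X^m with g is the coefficient of X^m in g.F times the product of the m_i!, which
   is nonzero in characteristic zero; so a nonzero g.F is detected by one of its own monomials. *)
- move=> k _ kd /AcompP[g gk ->] H; apply/eqP; apply/negPn/negP => g0.
  have /mpolyP : ct g <> 0 by move=> ctg; rewrite /apF ctg linear0 eqxx in g0.
  apply=> m; rewrite mcoeff0; apply/eqP; apply/negPn/negP => gm.
  have md := contr_coeff_deg Fd gk gm.
  have hm : ('X_[m] : P) \is (d - k).-homog by rewrite dhomogX /=; lia.
  have : apF 'X_[m] \in Acomp (d - k) by apply/AcompP; exists 'X_[m].
  move=> /H; rewrite (prFE _ gk) contrM contrX mcoeff_mderivm addm0 => /eqP.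
  rewrite -mulr_natr mulf_eq0 (negPf gm) /=.
  have [/(_ char0) -> _] := pcharf0P K; move=> /eqP p0.
  have : (0 < \prod_(i < 5) (m i) ^_ (m i))%N by apply: prodn_gt0 => i; rewrite ffact_gt0.
  by rewrite p0.
- by move=> k kd; apply: Acomp_dim; apply: hilb.
- exact: Acomp_top.
move=> i j i3 j3; rewrite !xop_apF /apF !contrXM /contr /contract.
rewrite msupp1 big_seq1 mcoeff1 eqxx scale1r mderivm0m (perazzo_xx Fform) //.
exact: linear0.
Qed.
End Model.

(** * Betti numbers *)

(** The map f identifies [Pv] modulo [Qv] with Z modulo B; the required family lifts a basis of a
    complement of B in Z. *)
Lemma qdim_image (K : fieldType) (V : lmodType K) (E : vectType K) (f : {linear V -> E})
    (Pv Qv : V -> Prop) (Z B : {vspace E}) :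
  Pv 0 -> (forall a u v, Pv u -> Pv v -> Pv (a *: u + v)) ->
  (forall v, Pv v -> f v \in Z) -> (forall z, z \in Z -> exists2 v, Pv v & f v = z) ->
  (forall v, Pv v -> (Qv v <-> f v \in B)) -> (B <= Z)%VS ->
  qdim_eq Pv Qv (\dim Z - \dim B).
Proof.
move=> P0 PD PZ Plift QB BZ.
have -> : (\dim Z - \dim B = \dim (Z :\: B))%N.
  by have := dimv_cap_compl Z B; rewrite (capv_idPr BZ); lia.
pose X := vbasis (Z :\: B)%VS.
have XZ (i : 'I_(\dim (Z :\: B))) : X`_i \in Z.
  by apply: (subvP (diffvSl Z B)); apply: vbasis_mem; rewrite mem_nth ?size_tuple.
have liftX (i : 'I_(\dim (Z :\: B))) : exists v, Pv v /\ f v = X`_i.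
  by have [v vP fv] := Plift _ (XZ i); exists v.
have [s sP] := fin_all_exists liftX.
have sumP a : Pv (\sum_i a i *: s i).
  elim/big_ind: _ => // [u v Pu Pv'|i _]; first by rewrite -[u]scale1r; apply: PD.
  by rewrite -[_ *: _]addr0; apply: PD => //; have [] := sP i.
have fsum a : f (\sum_i a i *: s i) = \sum_i a i *: X`_i.
  by rewrite linear_sum; apply: eq_bigr => i _; rewrite linearZ /=; have [_ ->] := sP i.
exists s; split; first by move=> i; have [] := sP i.
split=> [a /(QB _ (sumP a))|v vP].
  rewrite fsum => aB.
  have /freeP : free X by apply: basis_free (vbasisP _).
  apply; apply/eqP; rewrite -memv0 -(capv_diff Z B) memv_cap aB andbT.
  by apply: rpred_sum => i _; rewrite memvZ // vbasis_mem // mem_nth ?size_tuple.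
have /memv_addP[y yD [b bB vE]] : f v \in (Z :\: B + B)%VS.
  by rewrite addv_diff (addv_idPl BZ) PZ.
exists (fun i => coord X i y); apply/QB.
  by rewrite addrC -scaleN1r; apply: PD.
by rewrite linearB /= fsum -(coord_vbasis yD) vE addrC addKr.
Qed.

Section Betti.
Variables (K : fieldType) (d : nat) (F : {mpoly K[5]}).
Hypotheses (char0 : [pchar K] =i pred0) (d5 : (5 <= d)%N).
Hypothesis Fform : perazzo_form d F.
Hypothesis hilb : forall i, (i <= d)%N -> hilb_eq F i (min_hilb d i).
Local Notation P := {mpoly K[5]}.
Local Notation D := {ffun 'X_{1..5 < d.+1} -> K^o}.
Local Notation E := {ffun {set 'I_5} -> D}.

Let Fd : F \is d.-homog.
Proof. by apply: perazzo_homog Fform; lia. Qed.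

Let PM := perazzo_form_model char0 d5 Fd Fform hilb.

Definition apK (c : koszul K) : E := [ffun S : {set 'I_5} => apF d F (c S)].

Fact apK_linear : linear apK.
Proof. by move=> a u v; apply/ffunP=> S; rewrite !ffunE linearP. Qed.
HB.instance Definition _ := GRing.isLinear.Build K (koszul K) E _ apK apK_linear.

Lemma kann_apK c : kann F c <-> apK c = 0.
Proof.
split=> [cF|c0 S]; first by apply/ffunP=> S; rewrite !ffunE /apF /contr cF linear0.
apply: (apF_eq0 Fd); have := congr1 (fun c : E => c S) c0.
by rewrite !ffunE.
Qed.

Lemma kdiff_apK c : apK (kdiff c) = kd (@xop K d) (apK c).
Proof.
apply/ffunP=> T; rewrite !ffunE kdE linear_sum; apply: eq_bigr => k _.
rewrite ffunE (xop_apF Fd) -linearZ /=; congr (apF d F _).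
by rewrite -mulrA -signr_odd /ksgn -[in RHS]signr_odd mulr_sign scaler_sign.
Qed.

Lemma kdiff_linear : linear (@kdiff K).
Proof.
move=> a u v; apply/ffunP=> T; rewrite !ffunE scaler_sumr -big_split /=.
by apply: eq_bigr => k _; rewrite !ffunE mulrDr -scalerAr.
Qed.

Lemma kchain_linear i j a u v : kchain i j u -> kchain i j v -> kchain i j (a *: u + v : koszul K).
Proof.
move=> uC vC S; have := uC S; have := vC S; rewrite !ffunE.
case: ifP => _; first by move=> vS uS; apply: rpredD => //; apply: rpredZ.
by move=> /eqP-> /eqP->; rewrite scaler0 addr0.
Qed.

Lemma kchain0 i j : kchain i j (0 : koszul K).
Proof. by move=> S; rewrite ffunE; case: ifP => // _; apply: rpred0. Qed.

Lemma kchain_apK i k c : kchain i (i + k) c -> apK c \in chains 5 (Acomp d F) i k.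
Proof.
move=> cC; apply/chainsP=> S; have := cC S; rewrite ffunE leq_addr andbT addKn.
case: ifP => _ cS; first by apply/AcompP; exists (c S).
by rewrite (eqP cS) linear0.
Qed.

Lemma apK_lift i k e : e \in chains 5 (Acomp d F) i k ->
  exists2 c, kchain i (i + k) c & apK c = e.
Proof.
move=> /chainsP eC.
have lift_S (S : {set 'I_5}) : exists g : P,
    (if #|S| == i then g \is k.-homog else g == 0) /\ apF d F g = e S.
  have := eC S; case: ifP => _; first by move=> /AcompP[g gk ->]; exists g.
  by move=> /eqP->; exists 0; rewrite linear0.
have [c cP] := fin_all_exists lift_S.
exists [ffun S => c S]; last by apply/ffunP=> S; rewrite !ffunE; have [] := cP S.
by move=> S; rewrite ffunE leq_addr andbT addKn; have [] := cP S.
Qed.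

Lemma kchain_empty i j (c : koszul K) : (j < i)%N -> kchain i j c -> c = 0.
Proof.
move=> ji cC; apply/ffunP=> S; have := cC S; rewrite leqNgt ji andbF ffunE.
by move/eqP.
Qed.

(** Internal degree i + k means coefficients in A_k. Boundaries have their sources in A_{k-1}, so
    there are none for k = 0. *)
Lemma bettiE i k : betti_eq F i (i + k) (betti_table d i (i + k)).
Proof.
pose A := Acomp d F; pose dx := kd (@xop K d).
pose Z := (chains 5 A i k :&: lker dx)%VS.
pose B := if k is k'.+1 then (dx @: chains 5 A i.+1 k')%VS else 0%VS.
have dimA : \dim (A k) = if (k <= d)%N then min_hilb d k else 0%N.
  case: leqP => kd'; first exact: (pm_dim PM).
  by rewrite /A (pm_top PM) ?dimv0.
have -> : betti_table d i (i + k) = (\dim Z - \dim B)%N.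
  have dimB : (if k is k'.+1 then krank_table d i.+1 k' else 0%N) = \dim B.
    by rewrite /B; case: (k) => [|k']; rewrite ?dimv0 // -(krankE char0 d5 PM).
  have := krank_ker A (@xop K d) i k; rewrite -/Z dimA -(krank_table_betti i k d5) dimB.
  by rewrite (krankE char0 d5 PM); lia.
have dxdx c : dx (dx c) = 0.
  by apply: kd_comp0 => S j l _ _ _; apply: (pm_comm PM).
apply: (@qdim_image K (koszul K) E apK).
- split; first exact: kchain0.
  by apply/kann_apK; rewrite kdiff_apK !linear0.
- move=> a u v [uC /kann_apK uZ] [vC /kann_apK vZ]; split; first exact: kchain_linear.
  by apply/kann_apK; rewrite kdiff_linear linearP /= uZ vZ scaler0 addr0.
- move=> c [cC /kann_apK cZ]; rewrite memv_cap kchain_apK // memv_ker.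
  by rewrite /dx -kdiff_apK cZ eqxx.
- move=> z /memv_capP[zC]; rewrite memv_ker => /eqP zZ.
  have [c cC cz] := apK_lift zC; exists c => //; split=> //.
  by apply/kann_apK; rewrite kdiff_apK cz.
- move=> c [cC _]; rewrite /B; split.
    case=> _ [b [bC /kann_apK]]; rewrite linearB /= => /eqP; rewrite subr_eq0 kdiff_apK => /eqP->.
    case: (k) bC => [|k'] bC; last by apply: memv_img; apply: kchain_apK; rewrite addSnnS.
    by rewrite (kchain_empty _ bC) ?addn0 // !linear0 mem0v.
  move=> cB; split=> //; move: cB; case: (k) => [|k'].
    rewrite memv0 => /eqP c0; exists 0; split; first exact: kchain0.
    by apply/kann_apK; rewrite linearB /= kdiff_apK c0 !linear0 ?subr0 ?addr0.
  move=> /memv_imgP[e eC ce]; have [b bC be] := apK_lift eC; exists b; split.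
    by rewrite -addSnnS.
  by apply/kann_apK; rewrite linearB /= kdiff_apK be ce subrr.
rewrite /B /Z; case: (k) => [|k']; first exact: sub0v.
apply/subvP=> _ /memv_imgP[e eC ->]; rewrite memv_cap memv_ker dxdx eqxx andbT.
by apply: kd_chains eC => j v; apply: (pm_deg PM).
Qed.

Lemma betti_low i j : (j < i)%N -> betti_eq F i j (betti_table d i j).
Proof.
move=> ji; have -> : betti_table d i j = 0%N.
  rewrite /betti_table; case: i ji => [|[|[|[|[|[|i]]]]]] // ji; lia.
have c0 c : kcycle F i j c -> c = 0 by case=> + _; apply: kchain_empty.
exists (fun=> 0); split; first by case.
split=> [a _|c /c0 ->]; first by case.
exists (fun=> 0); rewrite big_ord0 subr0; split; first exact: kchain0.
exists 0; split; first exact: kchain0.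
by apply/kann_apK; rewrite linearB /= kdiff_apK !linear0 ?subr0 ?addr0.
Qed.
End Betti.

Theorem theorem5p4 (K : closedFieldType) (charK0 : [pchar K]%R =i pred0)
  (d : nat) (F : {mpoly K[5]}) :
  (5 <= d)%N ->
  perazzo_form d F ->
  (forall i, (i <= d)%N -> hilb_eq F i (min_hilb d i)) ->
  forall i j, betti_eq F i j (betti_table d i j).
Proof.
move=> d5 Fform hilb i j; have [ji|ij] := ltnP j i; first exact: betti_low.
by rewrite -(subnKC ij); apply: bettiE.
Qed.
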